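(* Let $N\ge 3$, let $D\subset\mathbb{R}^N$ be a bounded Lipschitz domain, and let $\varphi:\mathbb{R}_+\to\mathbb{R}_+$ be a continuous nondecreasing function with $\varphi(0)=0$. Assume that there exists $\varepsilon>0$ such that $$\int_0^\varepsilon\left(\int_0^s\varphi(r)\,dr\right)^{-\frac12}ds<\infty.$$ Then there exists a nonnegative continuous function $f$ on $\partial D$ such that $H_D^\varphi f\not\approx H_Df$.
   Context: $\mathbb{R}_+=[0,\infty[$, and $0^{-1/2}=+\infty$ by convention. For $f\in\mathcal{C}(\partial D)$, $H_Df$ denotes the unique function in $\mathcal{C}(\overline{D})$ that is harmonic in $D$ and equals $f$ on $\partial D$. For nonnegative $f\in\mathcal{C}(\partial D)$, $H_D^\varphi f$ denotes the unique nonnegative function $u\in\mathcal{C}(\overline{D})$ satisfying $\Delta u=2\varphi(u)$ in $D$ (in the sense of distributions) and $u=f$ on $\partial D$; existence and uniqueness are known for $\varphi$ continuous nondecreasing with $\varphi(0)=0$. For two nonnegative functions $u,v$ on $D$, $u\approx v$ ($u$ and $v$ are proportional) means that there exists a constant $c>0$ such that $\frac1c v(x)\le u(x)\le c\,v(x)$ for every $x\in D$; $u\not\approx v$ means that no such constant exists. *)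

(* Defs.v *)
From HB Require Import structures.
From mathcomp Require Import all_boot all_order all_algebra.
From mathcomp Require Import all_classical all_reals all_analysis.

Set Implicit Arguments.
Unset Strict Implicit.
Unset Printing Implicit Defensive.

Import Order.TTheory GRing.Theory Num.Theory.
Import numFieldNormedType.Exports.

Local Open Scope classical_set_scope.
Local Open Scope ring_scope.

Definition boundary (T : topologicalType) (D : set T) : set T :=
  closure D `\` interior D.

(* Up to an orthogonal change of coordinates y = x *m Q, near each of its
   boundary points D is the part of space strictly above the graph of a
   Lipschitz function of the coordinates other than y_i.  No translation is
   needed, because g is arbitrary; the sup norm of 'rV_N.-1 in the Lipschitz
   condition only affects the constant. *)
Definition locally_lipschitz_graph (R : realType) (N : nat)
    (D : set 'rV[R]_N) (z : 'rV[R]_N) : Prop :=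
  exists (U : set 'rV[R]_N) (Q : 'M[R]_N) (i : 'I_N)
         (g : 'rV[R]_N.-1 -> R) (k : R),
    [/\ open U /\ U z,
        Q *m Q^T = 1%:M,
        k.-lipschitz g &
        D `&` U =
          [set x | g (col' i (x *m Q)) < (x *m Q) ord0 i] `&` U].

Definition bounded_lipschitz_domain (R : realType) (N : nat)
    (D : set 'rV[R]_N) : Prop :=
  [/\ D !=set0, open D, connected D, bounded_set D &
      forall z, boundary D z -> locally_lipschitz_graph D z].

Definition partial (R : realType) (N : nat) (i : 'I_N) (f : 'rV[R]_N -> R) :
  'rV[R]_N -> R := fun x => 'D_('e_i) f x.

Definition laplacian (R : realType) (N : nat) (f : 'rV[R]_N -> R) :
  'rV[R]_N -> R := fun x => \sum_(i < N) partial i (partial i f) x.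

(* f is of class C^k on the open set D. *)
Fixpoint C_on (R : realType) (N : nat) (k : nat) (D : set 'rV[R]_N)
    (f : 'rV[R]_N -> R) : Prop :=
  (forall x, D x -> {for x, continuous f}) /\
  match k with
  | 0 => True
  | k'.+1 => forall i : 'I_N,
      (forall x, D x -> derivable f x 'e_i) /\ C_on k' D (partial i f)
  end.

Definition harmonic_on (R : realType) (N : nat) (D : set 'rV[R]_N)
    (h : 'rV[R]_N -> R) : Prop :=
  C_on 2 D h /\ forall x, D x -> laplacian h x = 0.

Definition test_function (R : realType) (N : nat) (D : set 'rV[R]_N)
    (psi : 'rV[R]_N -> R) : Prop :=
  (forall k, C_on k setT psi) /\
  exists K : set 'rV[R]_N,
    [/\ compact K, K `<=` D & forall x, ~ K x -> psi x = 0].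

(* Iterated one-dimensional Lebesgue integrals.  Below, the integrands are
   continuous with compact support, for which Fubini's theorem identifies this
   with the integral against N-dimensional Lebesgue measure. *)
Fixpoint integral_rV (R : realType) (N : nat) : ('rV[R]_N -> R) -> R :=
  match N with
  | 0 => fun g => g 0
  | n.+1 => fun g =>
      \int[@lebesgue_measure R]_t
        integral_rV (fun x : 'rV[R]_n => g (row_mx t%:M x))
  end.

(* Equality of distributions on D between the Laplacian of u and v, for u and v
   continuous on D; the values of u and v outside D play no role, since psi and
   its Laplacian vanish there. *)
Definition distr_laplacian_eq (R : realType) (N : nat) (D : set 'rV[R]_N)
    (u v : 'rV[R]_N -> R) : Prop :=
  forall psi, test_function D psi ->
    integral_rV (fun x => u x * laplacian psi x) =
    integral_rV (fun x => v x * psi x).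

Definition dirichlet_solution (R : realType) (N : nat) (D : set 'rV[R]_N)
    (f h : 'rV[R]_N -> R) : Prop :=
  [/\ {within closure D, continuous h},
      harmonic_on D h &
      forall x, boundary D x -> h x = f x].

Definition semilinear_solution (R : realType) (N : nat) (D : set 'rV[R]_N)
    (phi : R -> R) (f u : 'rV[R]_N -> R) : Prop :=
  [/\ {within closure D, continuous u},
      forall x, closure D x -> 0 <= u x,
      distr_laplacian_eq D u (fun x => 2 * phi (u x)) &
      forall x, boundary D x -> u x = f x].

(* A function on the boundary or on the closure of D is represented by a
   function on the whole space whose other values are irrelevant; uniqueness of
   the solutions, hence of the values of HD and HDphi, is thus understood on the
   closure of D.  The default value of get, the zero function, is never used for
   the data of interest, as both Dirichlet problems are known to be solvable. *)
Definition HD (R : realType) (N : nat) (D : set 'rV[R]_N)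
    (f : 'rV[R]_N -> R) : 'rV[R]_N -> R :=
  get [set h | dirichlet_solution D f h].

Definition HDphi (R : realType) (N : nat) (D : set 'rV[R]_N)
    (phi : R -> R) (f : 'rV[R]_N -> R) : 'rV[R]_N -> R :=
  get [set u | semilinear_solution D phi f u].

Definition proportional_on (R : realType) (T : Type) (D : set T)
    (u v : T -> R) : Prop :=
  exists2 c : R, 0 < c & forall x, D x -> c^-1 * v x <= u x <= c * v x.

(* Main.v *)
Require Import Defs.
From mathcomp Require Import all_boot all_order all_algebra.
From mathcomp Require Import all_classical all_reals all_analysis.
From mathcomp Require Import measurable_realfun ring lra.
Import Order.TTheory GRing.Theory Num.Theory.
Import numFieldNormedType.Exports.
Local Open Scope classical_set_scope.
Local Open Scope ring_scope.

(** A small constant boundary value c is enough.  The harmonic function with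
boundary values c is c itself, whereas every solution u of Delta u = 2 phi(u)
with boundary values c vanishes at a prescribed point x0 of D once c > 0 is
small: the integral condition makes the solutions of the underlying ordinary
differential equation reach zero at a finite distance, so that u has a dead
core.  As u x0 = 0 < c, no constant makes the two functions proportional.

The dead core comes from a barrier.  Let Phi be the primitive of phi; by
hypothesis T(s) = int_0^s Phi^(-1/2) is finite, and its inverse U satisfies
U' = Phi(U)^(1/2) and U(0) = U'(0) = 0 although U > 0 on ]0, tau]
([exists_profile]).  The function w(x) = sum_i U(min(|x_i - x0_i| / (2N), theta))
vanishes at x0, is at least c := U(theta) outside D when theta is small, and
satisfies Delta w <= 2 phi(w) in the sense that its second differences
w(y + h e_i) + w(y - h e_i) - 2 w(y), summed over i, are at most
2 h^2 phi(w(y) + sigma) for h small ([sum_barrier_diff2]).  A sum of functions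
of one coordinate is used instead of a radial function because its second
differences are those of the profile; neither U nor w is ever differentiated.
The comparison principle then gives u <= w, hence u x0 <= 0.

The comparison principle ([comparison]) concerns a function u that is only
continuous and an equation that only holds in the sense of distributions.  If
u - w were positive somewhere, adding a small multiple of a squared distance
would produce an interior maximum of u - w where u > w ([perturbed_max]), and
bending the barrier slightly there would make this maximum strict while keeping
a gap between 2 phi(u) and the second differences of the bent barrier W.  Then u
is mollified by test functions that are products of bumps of one variable.  The
second differences of the mollified u are h^2 times the integral of u against
the Laplacian of the test function, up to o(h^2); by the equation they are at
least h^2 min 2 phi(u) up to o(h^2) ([sum_mollify_diff2]).  At a point where the
mollified u minus W almost reaches its supremum this contradicts the gap
([no_strict_max]).  Product bumps keep the analysis one-dimensional: their
partial derivatives are again products, and the iterated integral of a product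
is the product of the integrals.

On the harmonic side only the bound h >= c is needed, and it follows from
[perturbed_max] and the second derivative test ([harmonic_min]). *)

(** * Smooth functions of one variable and mollifiers *)

(** Smoothness in one variable is phrased by successive derivatives, so that it
matches the iterated partial derivatives required of a test function. *)
Fixpoint smooth1 (R : realType) (k : nat) (a : R -> R) : Prop :=
  match k with
  | 0 => continuous a
  | k'.+1 => (forall t, derivable a t 1) /\ smooth1 R k' (a^`())%classic
  end.
Arguments smooth1 {R}.

Lemma derivable1_continuous (R : realType) (a : R -> R) :
  (forall t, derivable a t 1) -> continuous a.
Proof.
by move=> da t; apply: differentiable_continuous; apply/derivable1_diffP.
Qed.

Lemma smooth1_continuous (R : realType) k (a : R -> R) :
  smooth1 k a -> continuous a.
Proof. by case: k => //= k [da _]; exact: derivable1_continuous. Qed.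

Lemma smooth1W (R : realType) k (a : R -> R) : smooth1 k.+1 a -> smooth1 k a.
Proof.
elim: k a => [|k IH] a [da sa]; first exact: derivable1_continuous.
by split => //; exact: IH.
Qed.

Lemma smooth1D (R : realType) k (a b : R -> R) :
  smooth1 k a -> smooth1 k b -> smooth1 k (fun t => a t + b t).
Proof.
elim: k a b => [|k IH] a b /=.
  by move=> ca cb t; apply: cvgD; [exact: ca|exact: cb].
move=> [da sa] [db sb]; split; first by move=> t; exact: derivableD.
suff -> : ((fun t => a t + b t)^`())%classic =
  (fun t => a^`()%classic t + b^`()%classic t) by exact: IH.
by apply/funext => t; rewrite !derive1E; exact: deriveD.
Qed.

Lemma smooth1M (R : realType) k (a b : R -> R) :
  smooth1 k a -> smooth1 k b -> smooth1 k (fun t => a t * b t).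
Proof.
elim: k a b => [|k IH] a b.
  by move=> ca cb t; apply: cvgM; [exact: ca|exact: cb].
move=> sa sb; have [da sa'] := sa; have [db sb'] := sb.
split; first by move=> t; exact: derivableM.
suff -> : ((fun t => a t * b t)^`())%classic =
    (fun t => a t * b^`()%classic t + b t * a^`()%classic t).
  by apply: smooth1D; apply: IH => //; exact: smooth1W.
by apply/funext => t; rewrite !derive1E; exact: deriveM.
Qed.

Lemma smooth1_cst (R : realType) k (c : R) : smooth1 k (fun _ : R => c).
Proof.
elim: k c => [|k IH] c; first by move=> t; exact: cvg_cst.
split; first by move=> t; exact: derivable_cst.
suff -> : ((fun=> c)^`())%classic = (fun _ : R => (0 : R)) by exact: IH.
by apply/funext => t; rewrite derive1E derive_cst.
Qed.

Lemma smooth1_affine (R : realType) k (a : R -> R) (c d : R) :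
  smooth1 k a -> smooth1 k (fun t => a (c * t + d)).
Proof.
have daff (t : R) : is_derive t 1 (fun t : R => c * t + d) c.
  have -> : (fun t : R => c * t + d) = (c *: id) + cst d by [].
  by apply: is_derive_eq; rewrite /GRing.scale /= mulr1 addr0.
have daa (b : R -> R) (t : R) : derivable b (c * t + d) 1 ->
    is_derive t 1 (fun t : R => b (c * t + d)) (b^`()%classic (c * t + d) * c).
  move=> db; apply: (@is_derive1_comp _ b (fun t : R => c * t + d)).
  by rewrite derive1E; apply: DeriveDef.
elim: k a => [|k IH] a.
  move=> ca t; apply: (@continuous_comp _ _ _ (fun t : R => c * t + d) a).
    by apply: differentiable_continuous; apply/derivable1_diffP; apply: ex_derive.
  exact: ca.
move=> [da sa]; split.
  by move=> t; apply: (@ex_derive _ _ _ _ _ _ _ (daa _ _ (da _))).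
suff -> : ((fun t => a (c * t + d))^`())%classic =
    (fun t => a^`()%classic (c * t + d) * c).
  by apply: smooth1M; [exact: IH|exact: smooth1_cst].
by apply/funext => t; rewrite derive1E; have [_ ->] := daa _ _ (da (c * t + d)).
Qed.

(** The family t^(-n) exp(-1/t) extended by zero is closed under differentiation
up to linear combinations, which makes the smoothness of the n = 0 member an
induction on the order. *)
Definition flat (R : realType) (n : nat) (t : R) : R :=
  if 0 < t then t^-1 ^+ n * expR (- t^-1) else 0.

Lemma flat_ge0 (R : realType) n (t : R) : 0 <= flat R n t.
Proof.
rewrite /flat; case: ltP => // t0.
by rewrite mulr_ge0 ?expR_ge0// exprn_ge0 // invr_ge0 ltW.
Qed.

(** The exponential series at 1/t gives exp(1/t) >= t^(-n-1) / (n+1)!.  This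
bound is what makes the difference quotients of [flat] at 0 tend to zero. *)
Lemma flat_le (R : realType) n (t : R) :
  flat R n t <= (n.+1)`!%:R * `|t|.
Proof.
rewrite /flat; case: ltP => t0; last by rewrite mulr_ge0.
have K0 : 0 < (n.+1)`!%:R :> R by rewrite ltr0n fact_gt0.
have := @expR_ge1Dxn R t^-1 n; rewrite invr_ge0 (ltW t0) => /(_ isT) H.
rewrite gtr0_norm // expRN ler_pdivrMr ?expR_gt0//.
have {}H : t^-1 ^+ n.+1 / n.+1`!%:R <= expR t^-1.
  by apply: le_trans H; rewrite lerDr.
rewrite ler_pdivrMr // exprS in H.
have := ler_wpM2l (ltW t0) H; rewrite mulrA divff ?gt_eqF// mul1r.
by lra.
Qed.

Lemma is_derive_flat (R : realType) n (t : R) :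
  is_derive t 1 (flat R n) (flat R n.+2 t - n%:R * flat R n.+1 t).
Proof.
have [t0|t0|->] := ltgtP t 0.
- rewrite /flat !(ltNge 0) !(ltW t0) /= mulr0 subrr.
  apply: (@near_eq_is_derive _ _ _ (cst 0)).
  near=> s; rewrite ifF //; apply/negbTE; rewrite -leNgt ltW//.
  by near: s; exact: lt_nbhsl.
- rewrite /flat t0.
  apply: (@near_eq_is_derive _ _ _ (fun s : R => s^-1 ^+ n * expR (- s^-1))).
    by near=> s; rewrite ifT //; near: s; exact: lt_nbhsr.
  have dV : is_derive t 1 (fun s : R => s^-1) (- t ^- 2 *: 1).
    by apply: is_deriveV; rewrite gt_eqF.
  have dX := @is_deriveX _ _ _ n _ _ _ dV.
  have dN : is_derive t 1 (fun s : R => - s^-1) (- (- t ^- 2 *: 1)).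
    exact: is_deriveN.
  have dE : is_derive t 1 (fun s : R => expR (- s^-1))
      (expR (- t^-1) * - (- t ^- 2 *: 1)).
    exact: (@is_derive1_comp _ expR (fun s : R => - s^-1)).
  have := is_deriveM dX dE.
  have -> : (fun s : R => s^-1) ^+ n * (fun s : R => expR (- s^-1))
    = (fun s : R => s^-1 ^+ n * expR (- s^-1)).
    by apply/funext => s; rewrite /GRing.mul /= fctE.
  move=> H; apply: is_derive_eq; rewrite /GRing.scale /= !fctE.
  rewrite !mulr1 opprK.
  case: n {dX H} => [|n]; rewrite /= ?expr0 ?mul0r ?mulr0 ?subr0 ?addr0 ?mul1r.
    by rewrite mulrC exprVn.
  by rewrite -(exprVn t 2) !exprS; ring.
- have F0 m : flat R m 0 = 0 by rewrite /flat ltxx.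
  rewrite !F0 mulr0 subr0.
  have : h^-1 *: ((flat R n \o shift 0) h - flat R n 0) @[h --> (0:R)^'] --> (0:R).
    apply/cvgr0Pnorm_le => e e0.
    have K0 : 0 < (n.+2)`!%:R :> R by rewrite ltr0n fact_gt0.
    near=> h.
    have -> : h^-1 *: ((flat R n \o shift 0) h - flat R n 0) = flat R n.+1 h.
      rewrite F0 /= addr0 subr0 /GRing.scale /= /flat.
      by case: ltP => h0; rewrite ?mulr0// exprS mulrA.
    rewrite ger0_norm ?flat_ge0//; apply: (le_trans (flat_le _ _ _)).
    rewrite -ler_pdivlMl//.
    near: h; apply: dnbhs0_le; by rewrite mulr_gt0 ?invr_gt0.
  move=> H.
  have H' : h^-1 *: ((flat R n \o shift 0) (h *: 1) - flat R n 0)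
      @[h --> (0:R)^'] --> (0:R).
    by under eq_fun do rewrite [_ *: 1]mulr1.
  apply: DeriveDef; first by apply/cvg_ex; exists 0.
  exact/cvg_lim.
Unshelve. all: by end_near. Qed.

Lemma smooth1_flat (R : realType) k n : smooth1 k (flat R n).
Proof.
elim: k n => [|k IH] n.
  by apply: derivable1_continuous => t; have [] := is_derive_flat R n t.
split; first by move=> t; have [] := is_derive_flat R n t.
suff -> : ((flat R n)^`())%classic =
    (fun t => flat R n.+2 t + - n%:R * flat R n.+1 t).
  by apply: smooth1D; [|apply: smooth1M; first exact: smooth1_cst]; exact: IH.
apply/funext => t; rewrite derive1E.
by have [_ ->] := is_derive_flat R n t; rewrite mulNr.
Qed.

Lemma integral_translate (R : realType) (a : R -> R) (y : R) :
  continuous a -> (forall t, 0 <= a t) ->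
  \int[@lebesgue_measure R]_t a (t - y) = \int[@lebesgue_measure R]_t a t.
Proof.
move=> ca a0; rewrite /Rintegral; congr fine; apply/esym.
have dF (t : R) : is_derive t 1 (fun t : R => t - y) 1.
  by rewrite -[1 in X in is_derive _ _ _ X](addr0 1); apply: is_deriveD.
have dFE : ((fun t : R => t - y)^`())%classic = cst 1.
  by apply/funext => t; rewrite derive1E; have [_ ->] := dF t.
rewrite (@increasing_ge0_integration_by_substitutionT _ (fun t => t - y) a) //.
- by apply: eq_integral => t _; rewrite dFE /GRing.mul /= mulr1.
- by move=> u v uv; rewrite ltrD2r.
- by rewrite dFE => t; exact: cvg_cst.
- by rewrite dFE; exact: is_cvg_cst.
- by rewrite dFE; exact: is_cvg_cst.
- exact: cvg_addrr_Ny.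
- exact: cvg_addrr.
Qed.

Lemma continuous_itv_integrable (R : realType) (a : R -> R) (b c : R) :
  continuous a -> (@lebesgue_measure R).-integrable `[b, c] (EFin \o a).
Proof.
move=> ca; apply: continuous_compact_integrable; first exact: segment_compact.
exact: continuous_subspaceT.
Qed.

Lemma compact_support_integrable (R : realType) (a : R -> R) (M : R) :
  continuous a -> (forall t, M < `|t| -> a t = 0) ->
  (@lebesgue_measure R).-integrable setT (EFin \o a).
Proof.
move=> ca aM.
have := continuous_itv_integrable R a (- M) M ca.
rewrite integrable_mkcond //; apply: eq_integrable => // t _.
rewrite patchE /=; case: ifPn => //; rewrite notin_setE /= in_itv /= -ler_norml.
by move/negP; rewrite -ltNge => /aM ->.
Qed.

Lemma Rintegral_compact_support (R : realType) (a : R -> R) (M : R) :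
  (forall t, M < `|t| -> a t = 0) ->
  \int[@lebesgue_measure R]_t a t = \int[@lebesgue_measure R]_(t in `[- M, M]) a t.
Proof.
move=> aM; rewrite [RHS]Rintegral_mkcond; apply: eq_Rintegral => t _.
rewrite patchE /=; case: ifPn => //; rewrite notin_setE /= in_itv /= -ler_norml.
by move/negP; rewrite -ltNge => /aM ->.
Qed.

Lemma Rintegral_bound (R : realType) (a : R -> R) (M K : R) : 0 <= M ->
  continuous a -> (forall t, M < `|t| -> a t = 0) -> (forall t, `|a t| <= K) ->
  `|\int[@lebesgue_measure R]_t a t| <= K * (2 * M).
Proof.
move=> M0 ca aM aK; rewrite (Rintegral_compact_support R a M aM).
apply: (le_trans (le_normr_Rintegral _ (continuous_itv_integrable _ _ _ _ ca))) => //.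
have ca' : continuous (fun t => `|a t|).
  by move=> t; apply: cvg_norm; exact: ca.
apply: (@le_trans _ _ (\int[@lebesgue_measure R]_(t in `[- M, M]) (cst K t))).
  apply: le_Rintegral => //; apply: continuous_itv_integrable => // t; exact: cvg_cst.
rewrite Rintegral_cst //= lebesgue_measure_itv /= lte_fin.
case: ltP => [|MM]; first by rewrite opprK mulr_natl.
have -> : M = 0 by lra.
by rewrite /= !mulr0.
Qed.

(** The bump flat(e + t) flat(e - t), divided by its integral.  The normalization
is required for all translates, as the mollified function is to be compared at
neighbouring points. *)
Lemma exists_mollifier (R : realType) (e : R) : 0 < e ->
  exists a : R -> R,
    [/\ forall k, smooth1 k a, forall t, 0 <= a t,
        forall t, e <= `|t| -> a t = 0 &
        forall y, \int[@lebesgue_measure R]_t a (t - y) = 1].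
Proof.
move=> e0.
pose b (t : R) := flat R 0 (1 * t + e) * flat R 0 (- 1 * t + e).
have sb k : smooth1 k b.
  by apply: smooth1M; apply: smooth1_affine; exact: smooth1_flat.
have cb : continuous b := smooth1_continuous R 0 b (sb 0).
have b0 t : 0 <= b t by rewrite mulr_ge0 ?flat_ge0.
have be t : e <= `|t| -> b t = 0.
  rewrite /b /flat ler_normr => /orP[et|et].
    by rewrite [X in _ * X]ifF ?mulr0//; apply/negbTE; rewrite -leNgt; lra.
  by rewrite ifF ?mul0r//; apply/negbTE; rewrite -leNgt; lra.
have beM t : e < `|t| -> b t = 0 by move=> /ltW /be.
have ib := compact_support_integrable R b e cb beM.
have I0 : 0 < \int[@lebesgue_measure R]_t b t.
  have b00 : 0 < b 0.
    by rewrite /b !mulr0 !add0r /flat e0 mulr_gt0// !expr0 mul1r expR_gt0.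
  have [d d0 bd] : exists2 d, 0 < d & forall t, `|t| < d -> b 0 / 2 <= b t.
    have b02 : 0 < b 0 / 2 by rewrite divr_gt0.
    have /cvgrPdist_le/(_ _ b02)/nbhs_ballP[d /= d0 bd] := cb 0.
    exists d => // t td; have := bd t; rewrite /ball /= sub0r normrN => /(_ td).
    by rewrite ler_norml => /andP[_]; lra.
  have mI : measurable (`[- (d / 2), d / 2] : set (measurableTypeR R)) by [].
  apply: (@lt_le_trans _ _ (\int[@lebesgue_measure R]_(t in `[- (d / 2), d / 2]) b t)).
    apply: (@lt_le_trans _ _
      (\int[@lebesgue_measure R]_(t in `[- (d / 2), d / 2]) (cst (b 0 / 2) t))).
      rewrite Rintegral_cst //= lebesgue_measure_itv /= lte_fin ifT; last by lra.
      by rewrite mulr_gt0 ?divr_gt0//= opprK -splitr.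
    apply: le_Rintegral => //.
    - by apply: continuous_itv_integrable => // t; exact: cvg_cst.
    - exact: continuous_itv_integrable.
    - by move=> t /=; rewrite in_itv /= -ler_norml => td; apply: bd; lra.
  rewrite [X in X <= _]Rintegral_mkcond; apply: le_Rintegral => //.
    have ibd := continuous_itv_integrable R b (- (d / 2)) (d / 2) cb.
    rewrite (_ : EFin \o _ = (EFin \o b) \_ `[- (d / 2), d / 2]).
      by rewrite -integrable_mkcond.
    by apply/funext => t; rewrite /= !patchE; case: ifP.
  by move=> t _; rewrite patchE; case: ifP.
pose c := (\int[@lebesgue_measure R]_t b t)^-1.
have c0 : 0 < c by rewrite invr_gt0.
exists (fun t => c * b t); split.
- by move=> k; apply: smooth1M; [exact: smooth1_cst|exact: sb].
- by move=> t; rewrite mulr_ge0 // ltW.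
- by move=> t /be ->; rewrite mulr0.
- move=> y; rewrite (integral_translate R (fun t => c * b t)).
  + by rewrite RintegralZl// mulVf// gt_eqF.
  + by move=> t; apply: cvgM; [exact: cvg_cst|exact: cb].
  + by move=> t; rewrite mulr_ge0 // ltW.
Qed.

(** Heine's theorem in the asymmetric form where only one of the two points is
restricted to the compact set: coverings by neighbourhoods on which f varies by
at most e give it directly. *)
Lemma compact_uniform_continuity (R : realType) (V : normedModType R)
    (K : set V) (f : V -> R) : compact K ->
  (forall x, K x -> {for x, continuous f}) ->
  forall e, 0 < e -> exists2 d, 0 < d &
    forall x y, K x -> `|x - y| < d -> `|f x - f y| <= e.
Proof.
move=> cK cf e e0.
have e2 : 0 < e / 2 by rewrite divr_gt0.
have := (iffLR (compact_near_coveringP K) cK) R (0^'+)%R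
  (fun d x => forall y, `|x - y| < d -> `|f x - f y| <= e) _.
case.
  move=> x Kx.
  have /cvgrPdist_le/(_ _ e2)/nbhs_ballP[r /= r0 fr] := cf x Kx.
  exists (ball x (r / 2), [set d | 0 < d < r / 2]).
    split; first by apply: nbhsx_ballx; rewrite divr_gt0.
    near=> d; apply/andP; split; near: d; first exact: nbhs_right_gt.
    by apply: nbhs_right_lt; rewrite divr_gt0.
  move=> [z d] /= [xz /andP[d0 dr]] y zy.
  have fz := fr z; have fy := fr y.
  rewrite -ball_normE /= in xz fz fy.
  have xzr : `|x - z| < r by lra.
  have xyr : `|x - y| < r.
    have := ler_normD (x - z) (z - y); rewrite addrA subrK; lra.
  move: (fz xzr) (fy xyr) => {}fz {}fy.
  have := ler_normB (f x - f y) (f x - f z).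
  have -> : f x - f y - (f x - f z) = f z - f y by ring.
  lra.
move=> d /= d0 H; exists (d / 2); first by rewrite divr_gt0.
move=> x y Kx xy; apply: (H (d / 2)) => //=; last by rewrite divr_gt0.
by rewrite sub0r normrN ger0_norm ?divr_ge0 ?ltW//; lra.
Unshelve. all: by end_near. Qed.

Lemma derive1_support (R : realType) (a : R -> R) (e : R) :
  (forall t, e < `|t| -> a t = 0) -> forall t, e < `|t| -> a^`()%classic t = 0.
Proof.
move=> ae t et; rewrite derive1E.
have H : is_derive t 1 a 0.
  apply: (@near_eq_is_derive _ _ _ (cst 0)).
  near=> s; rewrite ae //; near: s.
  by apply: (cvgr_gt `|t|) => //; exact: cvg_norm.
by have [_ ->] := H.
Unshelve. all: by end_near. Qed.

(** The mean value theorem, applied first to s |-> a (s + h) - a s on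
[t - h, t] and then to the derivative of a. *)
Lemma second_difference_mvt (R : realType) (a : R -> R) (h t : R) :
  smooth1 2 a -> 0 < h ->
  exists2 s, `|s - t| <= h &
    a (t + h) + a (t - h) - 2 * a t = h ^+ 2 * a^`()^`()%classic s.
Proof.
move=> [da [dda cdda]] h0.
have da1 (s : R) : is_derive s 1 a (a^`()%classic s).
  by rewrite derive1E; apply: DeriveDef.
have dda1 (s : R) : is_derive s 1 (a^`()%classic) (a^`()^`()%classic s).
  by rewrite [X in is_derive _ _ _ X]derive1E; apply: DeriveDef.
pose k s := a (s + h) - a s.
have dk (s : R) : is_derive s 1 k (a^`()%classic (s + h) - a^`()%classic s).
  have dsh : is_derive s 1 (fun s : R => s + h) 1.
    by rewrite -[1 in X in is_derive _ _ _ X](addr0 1); apply: is_deriveD.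
  have := @is_derive1_comp _ a (fun s : R => s + h) s _ _ (da1 (s + h)) dsh.
  by rewrite mulr1 => ?; exact: is_deriveB.
have ck : continuous k by apply: derivable1_continuous => s; have [] := dk s.
have th : t - h < t by lra.
have [s1 s1t Hs1] := MVT th (fun s _ => dk s) (continuous_subspaceT ck).
have sh : s1 < s1 + h by lra.
have [s2 s2t Hs2] := MVT sh (fun s _ => dda1 s)
  (continuous_subspaceT (derivable1_continuous _ _ dda)).
exists s2.
  by move: s1t s2t; rewrite !in_itv /= ler_norml => /andP[? ?] /andP[? ?]; lra.
move: Hs1; rewrite /k Hs2 subrK => H.
rewrite expr2; nra.
Qed.

(** Uniformity in t is the point: the mollifier is translated to a centre that
depends on h, and the error must be o(h^2) whatever the centre. *)
Lemma second_difference_uniform (R : realType) (a : R -> R) (e : R) :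
  smooth1 2 a -> (forall t, e < `|t| -> a t = 0) ->
  forall eta, 0 < eta -> exists2 d, 0 < d & forall h, 0 < h -> h < d -> forall t,
    `|a (t + h) + a (t - h) - 2 * a t - h ^+ 2 * a^`()^`()%classic t|
      <= eta * h ^+ 2.
Proof.
move=> sa ae eta eta0.
have [da [dda cdda]] := sa.
have ae2 := derive1_support R _ e (derive1_support R a e ae).
have [d d0 H] := @compact_uniform_continuity R R `[- (e + 2), e + 2]
   (a^`()^`()%classic) (@segment_compact _ _ _) (fun x _ => cdda x) _ eta0.
exists (Num.min d 1); first by rewrite lt_min d0 ltr01.
move=> h h0; rewrite lt_min => /andP[hd h1] t.
have [te|te] := lerP `|t| (e + 1).
  have [s st ->] := second_difference_mvt R a h t sa h0.
  rewrite -mulrBr normrM ger0_norm ?exprn_ge0 ?(ltW h0)// mulrC.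
  apply: ler_wpM2r; first by rewrite exprn_ge0 // ltW.
  rewrite distrC; apply: H; last by rewrite distrC; lra.
  by rewrite /= in_itv /= -ler_norml; lra.
have H1 : e < `|t + h|.
  have := ler_normB (t + h) h; rewrite addrK (gtr0_norm h0); lra.
have H2 : e < `|t - h|.
  have := ler_normD (t - h) h; rewrite subrK (gtr0_norm h0); lra.
rewrite !ae ?ae2 ?mulr0 ?subr0 ?addr0 ?normr0; try lra.
by rewrite mulr_ge0 ?exprn_ge0 // ltW.
Qed.

Lemma continuous_distP (R : realType) (V : normedModType R) (f : V -> R) x :
  {for x, continuous f} <->
  forall e, 0 < e -> exists2 d, 0 < d & forall y, `|x - y| < d -> `|f x - f y| <= e.
Proof.
split=> [cf e e0|H].
  have /cvgrPdist_le/(_ _ e0)/nbhs_ballP[d /= d0 fd] := cf.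
  by exists d => // y xy; apply: fd; rewrite -ball_normE.
apply/cvgrPdist_le => e /H[d d0 fd]; apply/nbhs_ballP; exists d => //= y.
by rewrite -ball_normE; exact: fd.
Qed.

(** * The iterated integral on continuous functions with compact support *)

Lemma coord_le_norm (R : realType) n (x : 'rV[R]_n) i : `|x ord0 i| <= `|x|.
Proof.
rewrite [leRHS]mx_normrE.
exact: (le_bigmax _ (fun ij : 'I_1 * 'I_n => `|x ij.1 ij.2|) (ord0, i)).
Qed.

Lemma norm_le_coord (R : realType) n (x : 'rV[R]_n) M : 0 <= M ->
  (forall i, `|x ord0 i| <= M) -> `|x| <= M.
Proof.
move=> M0 xM; rewrite [leLHS]mx_normrE; apply/bigmax_le => // -[i j] _ /=.
by rewrite (ord1 i).
Qed.

Lemma norm_row_mx_sub (R : realType) n (t s : R) (x y : 'rV[R]_n) :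
  `|row_mx t%:M x - row_mx s%:M y| = Num.max `|t - s| `|x - y|.
Proof.
rewrite opp_row_mx add_row_mx.
have -> : t%:M - s%:M = (t - s)%:M :> 'M[R]_1.
  by apply/matrixP => i j; rewrite !mxE mulrnBl.
apply/eqP; rewrite eq_le; apply/andP; split.
  apply: norm_le_coord => [|i]; first by rewrite le_max normr_ge0.
  rewrite -(splitK i); case: (fintype.split i) => j /=.
    by rewrite row_mxEl mxE (ord1 j) eqxx mulr1n le_max lexx.
  by rewrite row_mxEr le_max coord_le_norm orbT.
rewrite ge_max; apply/andP; split.
  have := coord_le_norm _ _ (row_mx (t - s)%:M (x - y)) (lshift n ord0).
  by rewrite row_mxEl mxE eqxx mulr1n.
apply: norm_le_coord => // i.
have := coord_le_norm _ _ (row_mx (t - s)%:M (x - y)) (rshift 1 i).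
by rewrite row_mxEr.
Qed.

Lemma norm_row_mx (R : realType) n (t : R) (x : 'rV[R]_n) :
  `|row_mx t%:M x| = Num.max `|t| `|x|.
Proof.
have := norm_row_mx_sub R n t 0 x 0.
by rewrite (_ : 0%:M = 0) ?raddf0// row_mx0 !subr0 !addr0.
Qed.

Lemma continuous_slice (R : realType) n (t : R) (g : 'rV[R]_n.+1 -> R) :
  continuous g -> continuous (fun x : 'rV[R]_n => g (row_mx t%:M x)).
Proof.
move=> cg x; apply/continuous_distP => e e0.
have [d d0 gd] := (continuous_distP R _ g _).1 (cg (row_mx t%:M x)) e e0.
exists d => // y xy; apply: gd.
by rewrite norm_row_mx_sub subrr normr0 gt_max d0.
Qed.

(** Continuous functions supported in the ball of radius M: on this class the
iterated integral is linear and bounded, with constants depending on M only. *)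
Definition csupp (R : realType) n (M : R) (g : 'rV[R]_n -> R) :=
  continuous g /\ forall x, M < `|x| -> g x = 0.

Lemma csupp_slice (R : realType) n M (t : R) (g : 'rV[R]_n.+1 -> R) :
  csupp R n.+1 M g -> csupp R n M (fun x : 'rV[R]_n => g (row_mx t%:M x)).
Proof.
move=> [cg gM]; split; first exact: continuous_slice.
by move=> x Mx; apply: gM; rewrite norm_row_mx lt_max Mx orbT.
Qed.

Lemma csupp_lin (R : realType) n M c (g1 g2 : 'rV[R]_n -> R) :
  csupp R n M g1 -> csupp R n M g2 -> csupp R n M (fun x => g1 x + c * g2 x).
Proof.
move=> [c1 M1] [c2 M2]; split.
  move=> x; apply: (@continuousD _ _ _ g1 (fun x => c * g2 x)); first exact: c1.
  by apply: (@continuousM _ _ (cst c) g2); [exact: cst_continuous|exact: c2].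
by move=> x Mx; rewrite M1// M2// mulr0 addr0.
Qed.

Lemma continuous_norm_sub (R : realType) n (y : 'rV[R]_n) :
  continuous (fun x : 'rV[R]_n => `|y - x|).
Proof.
move=> x; apply/continuous_distP => c c0; exists c => // z xz.
apply: (le_trans (ler_dist_dist _ _)).
by rewrite opprB addrC addrA subrK distrC ltW.
Qed.

Lemma compact_norm_sub_le (R : realType) n (y : 'rV[R]_n) (M : R) :
  compact [set x : 'rV[R]_n | `|y - x| <= M].
Proof.
apply: bounded_closed_compact.
  exists (`|y| + M); split; first exact: num_real.
  move=> K MK x /= xM; have := ler_normB y (y - x).
  rewrite opprB addrC subrK; lra.
have -> : [set x : 'rV[R]_n | `|y - x| <= M] =
  (fun x : 'rV[R]_n => `|y - x|) @^-1` [set t | t <= M] by [].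
by apply: preimage_closed => [x _|]; [exact: continuous_norm_sub|exact: closed_le].
Qed.

Lemma csupp_unif (R : realType) n M (g : 'rV[R]_n -> R) :
  csupp R n M g -> forall e, 0 < e -> exists2 d, 0 < d &
    forall x y, `|x - y| < d -> `|g x - g y| <= e.
Proof.
move=> [cg gM] e e0.
have [d d0 H] := compact_uniform_continuity R _ _ g (compact_norm_sub_le R n 0 M)
   (fun x _ => cg x) e e0.
exists d => // x y xy.
have [xM|Mx] := lerP `|x| M; first by apply: H; rewrite //= sub0r normrN.
have [yM|My] := lerP `|y| M.
  by rewrite distrC; apply: H; rewrite /= ?sub0r ?normrN // distrC.
by rewrite !gM // subrr normr0 ltW.
Qed.

(** Linearity and the bound by (2M)^n must be proved by a simultaneous induction:
the integral over the last n variables is integrable in the first one because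
it is continuous, and continuity is obtained from the bound applied to the
difference of two slices, with uniform continuity. *)
Lemma integral_rV_lin_bound (R : realType) n (M : R) : 0 <= M ->
  (forall g K, csupp R n M g -> (forall x, `|g x| <= K) ->
     `|integral_rV g| <= K * (2 * M) ^+ n) /\
  (forall g1 g2 c, csupp R n M g1 -> csupp R n M g2 ->
     integral_rV (fun x => g1 x + c * g2 x) = integral_rV g1 + c * integral_rV g2).
Proof.
move=> M0; elim: n => [|n [IHb IHl]].
  by split => // g K _ gK; rewrite /= expr0 mulr1.
have slice0 g t : csupp R n.+1 M g -> M < `|t| ->
    integral_rV (fun x : 'rV[R]_n => g (row_mx t%:M x)) = 0.
  move=> sg Mt; apply/eqP; rewrite -normr_le0 -(mul0r ((2 * M) ^+ n)).
  apply: IHb; first exact: csupp_slice.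
  by move=> x; rewrite (sg.2 _ _) ?normr0// norm_row_mx lt_max Mt.
have cont g : csupp R n.+1 M g ->
    continuous (fun t => integral_rV (fun x : 'rV[R]_n => g (row_mx t%:M x))).
  move=> sg t; apply/continuous_distP => e e0.
  pose e' := e / ((2 * M) ^+ n + 1).
  have P0 : 0 < (2 * M) ^+ n + 1 by rewrite ltr_wpDl // exprn_ge0 // mulr_ge0.
  have e'0 : 0 < e' by rewrite divr_gt0.
  have [d d0 H] := csupp_unif R _ _ _ sg e' e'0.
  exists d => // s ts.
  have := IHl _ _ (-1) (csupp_slice R n M t g sg) (csupp_slice R n M s g sg).
  rewrite mulN1r => <-.
  apply: (@le_trans _ _ (e' * (2 * M) ^+ n)).
    apply: IHb; first by apply: csupp_lin; exact: csupp_slice.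
    move=> x; rewrite mulN1r; apply: H.
    by rewrite norm_row_mx_sub subrr normr0 gt_max ts d0.
  by rewrite /e' mulrAC ler_pdivrMr // ler_wpM2l ?(ltW e0)// lerDl.
split => [g K sg gK|g1 g2 c s1 s2] /=.
  rewrite exprSr [_ * (_ ^+ n * _)]mulrA; apply: Rintegral_bound => //.
  - exact: cont.
  - by move=> t; exact: slice0.
  - by move=> t; apply: IHb => //; exact: csupp_slice.
have int g : csupp R n.+1 M g -> (@lebesgue_measure R).-integrable setT
    (EFin \o (fun t => integral_rV (fun x : 'rV[R]_n => g (row_mx t%:M x)))).
  move=> sg; apply: (compact_support_integrable R _ M); first exact: cont.
  by move=> t; exact: slice0.
under eq_Rintegral => t _ do
  rewrite (IHl _ _ c (csupp_slice R n M t g1 s1) (csupp_slice R n M t g2 s2)).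
rewrite -RintegralZl//; last exact: int.
rewrite -RintegralD//; first exact: int.
apply: (compact_support_integrable R _ M).
  move=> t; apply: (@continuousM _ _ (cst c)); first exact: cst_continuous.
  exact: cont.
by move=> t Mt; rewrite slice0// mulr0.
Qed.

Lemma integral_rV_le (R : realType) n (M : R) (g1 g2 : 'rV[R]_n -> R) : 0 <= M ->
  csupp R n M g1 -> csupp R n M g2 -> (forall x, g1 x <= g2 x) ->
  integral_rV g1 <= integral_rV g2.
Proof.
move=> M0 s1 s2 g12.
have ge0 m (g : 'rV[R]_m -> R) : (forall x, 0 <= g x) -> 0 <= integral_rV g.
  elim: m g => [|m IH] g g0 //=.
  by apply: Rintegral_ge0 => t _; exact: IH.
rewrite -subr_ge0 -mulN1r -(integral_rV_lin_bound R n M M0).2//.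
by apply: ge0 => x; rewrite mulN1r subr_ge0.
Qed.

Lemma csupp0 (R : realType) n (M : R) : csupp R n M (fun=> 0).
Proof. by split => // x; exact: cst_continuous. Qed.

Lemma integral_rV0 (R : realType) n : integral_rV (fun _ : 'rV[R]_n => 0) = 0.
Proof.
have := (integral_rV_lin_bound R n 1 ler01).1 _ 0 (csupp0 R n 1).
rewrite mul0r => H; apply/eqP; rewrite -normr_le0; apply: H => x.
by rewrite normr0.
Qed.

Lemma integral_rVD (R : realType) n (M : R) (g1 g2 : 'rV[R]_n -> R) : 0 <= M ->
  csupp R n M g1 -> csupp R n M g2 ->
  integral_rV (fun x => g1 x + g2 x) = integral_rV g1 + integral_rV g2.
Proof.
move=> M0 s1 s2; have := (integral_rV_lin_bound R n M M0).2 g1 g2 1 s1 s2.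
by under eq_fun do rewrite mul1r; rewrite mul1r.
Qed.

Lemma integral_rVZ (R : realType) n (M c : R) (g : 'rV[R]_n -> R) : 0 <= M ->
  csupp R n M g -> integral_rV (fun x => c * g x) = c * integral_rV g.
Proof.
move=> M0 sg.
have := (integral_rV_lin_bound R n M M0).2 _ g c (csupp0 R n M) sg.
by under eq_fun do rewrite add0r; rewrite integral_rV0 add0r.
Qed.

Lemma csuppD (R : realType) n M (g1 g2 : 'rV[R]_n -> R) :
  csupp R n M g1 -> csupp R n M g2 -> csupp R n M (fun x => g1 x + g2 x).
Proof.
move=> s1 s2; have := csupp_lin R n M 1 g1 g2 s1 s2.
by under eq_fun do rewrite mul1r.
Qed.

Lemma csuppZ (R : realType) n M c (g : 'rV[R]_n -> R) :
  csupp R n M g -> csupp R n M (fun x => c * g x).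
Proof.
move=> sg; have := csupp_lin R n M c _ g (csupp0 R n M) sg.
by under eq_fun do rewrite add0r.
Qed.

Lemma csupp_sum (R : realType) n M (m : nat) (g : 'I_m -> 'rV[R]_n -> R) :
  (forall i, csupp R n M (g i)) -> csupp R n M (fun x => \sum_i g i x).
Proof.
move=> sg; elim: m g sg => [|m IH] g sg.
  by under eq_fun do rewrite big_ord0; exact: csupp0.
under eq_fun do rewrite big_ord_recl; apply: csuppD => //.
exact: (IH (fun i => g (lift ord0 i))).
Qed.

Lemma integral_rV_sum (R : realType) n M (m : nat) (g : 'I_m -> 'rV[R]_n -> R) :
  0 <= M -> (forall i, csupp R n M (g i)) ->
  integral_rV (fun x => \sum_i g i x) = \sum_i integral_rV (g i).
Proof.
move=> M0 sg; elim: m g sg => [|m IH] g sg.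
  by under eq_fun do rewrite big_ord0; rewrite integral_rV0 big_ord0.
under eq_fun do rewrite big_ord_recl.
rewrite (integral_rVD R n M)//; last by apply: csupp_sum => i.
by rewrite (IH (fun i => g (lift ord0 i)))// big_ord_recl.
Qed.

(** * Products of functions of one coordinate *)

Definition prodf (R : realType) n (a : 'I_n -> R -> R) (x : 'rV[R]_n) : R :=
  \prod_i a i (x ord0 i).

Lemma continuous_coord (R : realType) n (i : 'I_n) :
  continuous (fun x : 'rV[R]_n => x ord0 i).
Proof.
move=> x; apply/continuous_distP => e e0; exists e => // y /ltW.
by apply: le_trans; have := coord_le_norm _ _ (x - y) i; rewrite !mxE.
Qed.

Lemma continuous_prodf (R : realType) n (a : 'I_n -> R -> R) :
  (forall i, continuous (a i)) -> continuous (prodf R n a).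
Proof.
move=> ca; rewrite /prodf; elim: (index_enum _) => [|i s IH] x.
  by under eq_fun do rewrite big_nil; exact: cst_continuous.
under eq_fun do rewrite big_cons.
apply: (@continuousM _ _ (fun x : 'rV[R]_n => a i (x ord0 i))); last exact: IH.
by apply: (@continuous_comp _ _ _ (fun x : 'rV[R]_n => x ord0 i));
  [exact: continuous_coord|exact: ca].
Qed.

Lemma norm_gtP (R : realType) n (x : 'rV[R]_n) M : 0 <= M -> M < `|x| ->
  exists i, M < `|x ord0 i|.
Proof.
move=> M0 Mx; apply/not_existsP => H; move: Mx; apply/negP; rewrite -leNgt.
by apply: norm_le_coord => // i; rewrite leNgt; exact/negP.
Qed.

Lemma prodf_supp (R : realType) n (a : 'I_n -> R -> R) (y x : 'rV[R]_n) M : 0 <= M ->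
  (forall i t, M < `|y ord0 i - t| -> a i t = 0) -> M < `|y - x| ->
  prodf R n a x = 0.
Proof.
move=> M0 aM Mx; have [i] := norm_gtP _ _ _ _ M0 Mx.
by rewrite !mxE => Mi; rewrite /prodf (bigD1 i)//= aM// mul0r.
Qed.

Lemma csupp_prodf (R : realType) n (a : 'I_n -> R -> R) M : 0 <= M ->
  (forall i, continuous (a i)) -> (forall i t, M < `|t| -> a i t = 0) ->
  csupp R n M (prodf R n a).
Proof.
move=> M0 ca aM; split; first exact: continuous_prodf.
move=> x Mx; apply: (prodf_supp R n a 0 x M) => //; last by rewrite sub0r normrN.
by move=> i t; rewrite mxE sub0r normrN; exact: aM.
Qed.

Lemma row_mx_head (R : realType) n (t : R) (x : 'rV[R]_n) :
  (row_mx t%:M x : 'rV[R]_n.+1) ord0 ord0 = t.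
Proof.
rewrite mxE; case: splitP => j //= _.
by rewrite !mxE (ord1 j) mulr1n.
Qed.

Lemma row_mx_tail (R : realType) n (t : R) (x : 'rV[R]_n) i :
  (row_mx t%:M x : 'rV[R]_n.+1) ord0 (lift ord0 i) = x ord0 i.
Proof.
rewrite mxE; case: splitP => j /=; first by rewrite (ord1 j).
by rewrite /bump /= !add1n => -[ij]; congr (x _ _); exact/val_inj.
Qed.

(** Each step only takes a factor that does not depend on the remaining
variables out of the inner integral; no interchange of integrals occurs. *)
Lemma integral_rV_prodf (R : realType) n (a : 'I_n -> R -> R) M : 0 <= M ->
  (forall i, continuous (a i)) -> (forall i t, M < `|t| -> a i t = 0) ->
  integral_rV (prodf R n a) = \prod_i \int[@lebesgue_measure R]_t a i t.
Proof.
move=> M0; elim: n a => [|n IH] a ca aM; first by rewrite /= /prodf !big_ord0.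
rewrite big_ord_recl /=.
have E t : integral_rV (fun x : 'rV[R]_n => prodf R n.+1 a (row_mx t%:M x)) =
    a ord0 t * \prod_i \int[@lebesgue_measure R]_t a (lift ord0 i) t.
  rewrite -(IH (fun i => a (lift ord0 i)))//; last by move=> i s; exact: aM.
  rewrite -(integral_rVZ R n M)//; last by apply: csupp_prodf => // i s; exact: aM.
  congr integral_rV; apply/funext => x; rewrite /prodf big_ord_recl.
  congr (a _ _ * _).
    exact: row_mx_head.
  apply: eq_bigr => i _; congr (a _ _).
  exact: row_mx_tail.
transitivity (\int[@lebesgue_measure R]_t
    (a ord0 t * \prod_i \int[@lebesgue_measure R]_t a (lift ord0 i) t)).
  by apply: eq_Rintegral => t _; exact: E.
by rewrite RintegralZr//; apply: (compact_support_integrable R _ M) => //; exact: aM.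
Qed.

(** Replacing the i-th factor is what a partial derivative does to a product of
functions of one coordinate, so the class of such products is stable. *)
Definition upd (R : realType) n (a : 'I_n -> R -> R) (i : 'I_n) (b : R -> R) :=
  fun j => if j == i then b else a j.

Lemma prodf_upd (R : realType) n (a : 'I_n -> R -> R) i b x :
  prodf R n (upd R n a i b) x = b (x ord0 i) * \prod_(j | j != i) a j (x ord0 j).
Proof.
rewrite /prodf (bigD1 i)//= /upd eqxx; congr (_ * _).
by apply: eq_bigr => j /negbTE ->.
Qed.

Lemma prodfD1 (R : realType) n (a : 'I_n -> R -> R) i x :
  prodf R n a x = a i (x ord0 i) * \prod_(j | j != i) a j (x ord0 j).
Proof. by rewrite /prodf (bigD1 i). Qed.

Lemma is_derive_prodf (R : realType) n (a : 'I_n -> R -> R) i (x : 'rV[R]_n) :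
  derivable (a i) (x ord0 i) 1 ->
  is_derive x 'e_i (prodf R n a) (prodf R n (upd R n a i (a i)^`()%classic) x).
Proof.
move=> da; rewrite prodf_upd.
set C := \prod_(j | j != i) _.
suff H : h^-1 *: ((prodf R n a \o shift x) (h *: 'e_i) - prodf R n a x) @[h --> (0:R)^']
    --> (a i)^`()%classic (x ord0 i) * C.
  by apply: DeriveDef; [apply/cvg_ex; eexists; exact: H|exact/cvg_lim].
have -> : (fun h => h^-1 *: ((prodf R n a \o shift x) (h *: 'e_i) - prodf R n a x))
   = (fun h => (h^-1 *: ((a i \o shift (x ord0 i)) (h *: 1) - a i (x ord0 i))) * C).
  apply/funext => h /=.
  rewrite !(prodfD1 R n a i) !mxE !eqxx /GRing.scale /= !mulr1 -mulrA mulrBl.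
  congr (_ * (_ * _ - _)); apply: eq_bigr => j ji.
  by rewrite !mxE eqxx (negbTE ji) mulr0 add0r.
apply: cvgM; last exact: cvg_cst. by rewrite derive1E; exact: da.
Qed.

Lemma partial_prodf (R : realType) n (a : 'I_n -> R -> R) i :
  (forall t, derivable (a i) t 1) ->
  partial i (prodf R n a) = prodf R n (upd R n a i (a i)^`()%classic).
Proof.
move=> da; apply/funext => x; rewrite /partial.
by have [_ ->] := is_derive_prodf R n a i x (da _).
Qed.

Lemma C_on_prodf (R : realType) n k D (a : 'I_n -> R -> R) :
  (forall i, smooth1 k (a i)) -> C_on k D (prodf R n a).
Proof.
elim: k a => [|k IH] a sa.
  by split => // x _; apply: continuous_prodf => i; exact: sa.
split=> [x _|i].
  by apply: continuous_prodf => i; exact: smooth1_continuous (sa i).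
have [da sa'] := sa i.
split; first by move=> x _; have [] := is_derive_prodf R n a i x (da _).
rewrite partial_prodf//; apply: IH => j; rewrite /upd.
by case: eqP => _ //; exact: smooth1W.
Qed.

Lemma laplacian_prodf (R : realType) n (a : 'I_n -> R -> R) x :
  (forall i, smooth1 2 (a i)) ->
  laplacian (prodf R n a) x =
  \sum_i prodf R n (upd R n a i (a i)^`()^`()%classic) x.
Proof.
move=> sa; apply: eq_bigr => i _.
have [da [dda _]] := sa i.
rewrite partial_prodf// partial_prodf; last by rewrite /upd eqxx.
by rewrite !prodf_upd /upd eqxx; congr (_ * _); apply: eq_bigr => j /negbTE ->.
Qed.

(** * Mollification by product bumps *)

(** Continuity of u near the support of s is enough for the continuity of the
product on the whole space, whatever u is elsewhere. *)
Lemma csupp_mul (R : realType) n (y : 'rV[R]_n) (e M : R) (u s : 'rV[R]_n -> R) :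
  0 <= e -> `|y| + e <= M ->
  (forall x, `|y - x| <= e -> {for x, continuous u}) ->
  continuous s -> (forall x, e < `|y - x| -> s x = 0) ->
  csupp R n M (fun x => u x * s x).
Proof.
move=> e0 yeM cu cs s0; split.
  move=> x; have [xe|xe] := lerP `|y - x| e.
    by apply: (@continuousM _ _ u s); [exact: cu|exact: cs].
  apply/continuous_distP => c c0; exists (`|y - x| - e); first by rewrite subr_gt0.
  move=> z xz; rewrite !s0 ?mulr0 ?subrr ?normr0 ?ltW//.
  have := ler_normD (y - z) (z - x); rewrite addrA subrK [`|z - x|]distrC; lra.
move=> x Mx; rewrite s0 ?mulr0//.
have := ler_normB y (y - x); rewrite opprB addrC subrK; lra.
Qed.

Section mollification.
Variables (R : realType) (N : nat) (a : R -> R) (e : R).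
Hypotheses (e0 : 0 < e) (sa : forall k, smooth1 k a) (a0 : forall t, 0 <= a t)
  (ae : forall t, e <= `|t| -> a t = 0)
  (a1 : forall y, \int[@lebesgue_measure R]_t a (t - y) = 1).

Definition bumps (y : 'rV[R]_N) (i : 'I_N) (t : R) : R := a (t - y ord0 i).

Definition mollify (u : 'rV[R]_N -> R) (y : 'rV[R]_N) : R :=
  integral_rV (fun x => u x * prodf R N (bumps y) x).

Lemma smooth1_bumps k (y : 'rV[R]_N) i : smooth1 k (bumps y i).
Proof.
have := smooth1_affine R k a 1 (- y ord0 i) (sa k).
by under eq_fun do rewrite mul1r.
Qed.

Lemma bumps_supp (y : 'rV[R]_N) i t : e < `|y ord0 i - t| -> bumps y i t = 0.
Proof. by move=> H; apply: ae; rewrite distrC ltW. Qed.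

Lemma continuous_bumps (y : 'rV[R]_N) i : continuous (bumps y i).
Proof. exact: (smooth1_continuous R 0 _ (smooth1_bumps 0 y i)). Qed.

Lemma prodf_bumps_ge0 (y x : 'rV[R]_N) : 0 <= prodf R N (bumps y) x.
Proof. by apply: prodr_ge0 => i _; exact: a0. Qed.

Lemma prodf_bumps_eq0 (y x : 'rV[R]_N) : e < `|y - x| -> prodf R N (bumps y) x = 0.
Proof.
by apply: (prodf_supp R N (bumps y) y x e) => [|i t]; [exact: ltW|exact: bumps_supp].
Qed.

Lemma csupp_bumps y M : `|y| + e <= M -> csupp R N M (prodf R N (bumps y)).
Proof.
move=> yM; have := csupp_mul R N y e M (cst 1) (prodf R N (bumps y)) (ltW e0) yM.
under [X in csupp _ _ _ X]eq_fun do rewrite mul1r; apply.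
- by move=> x _; exact: cst_continuous.
- by apply: continuous_prodf => i; exact: continuous_bumps.
- by move=> x; exact: prodf_bumps_eq0.
Qed.

Lemma csupp_mul_bumps (y : 'rV[R]_N) M (u : 'rV[R]_N -> R) : `|y| + e <= M ->
  (forall x, `|y - x| <= e -> {for x, continuous u}) ->
  csupp R N M (fun x => u x * prodf R N (bumps y) x).
Proof.
move=> yM cu; apply: csupp_mul cu _ _ => //; first exact: ltW.
- by apply: continuous_prodf => i; exact: continuous_bumps.
- by move=> x; exact: prodf_bumps_eq0.
Qed.

Lemma integral_bumps (y : 'rV[R]_N) : integral_rV (prodf R N (bumps y)) = 1.
Proof.
rewrite (integral_rV_prodf _ _ _ (`|y| + e)).
- by rewrite big1 // => i _; exact: a1.
- by rewrite addr_ge0 // ltW.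
- by move=> i; exact: continuous_bumps.
- move=> i t yt; apply: bumps_supp.
  have := ler_normB (y ord0 i) (y ord0 i - t).
  have := coord_le_norm _ _ y i; rewrite opprB addrC subrK; lra.
Qed.

Lemma mollify_le y (u : 'rV[R]_N -> R) m :
  (forall x, `|y - x| <= e -> {for x, continuous u}) ->
  (forall x, `|y - x| <= e -> u x <= m) -> mollify u y <= m.
Proof.
move=> cu um; have M0 : 0 <= `|y| + e by rewrite addr_ge0 // ltW.
have sb := csupp_bumps y _ (lexx _).
rewrite -[leRHS]mulr1 -(integral_bumps y) -(integral_rVZ _ _ (`|y| + e))//.
apply: (integral_rV_le _ _ (`|y| + e)) => //.
- exact: csupp_mul_bumps.
- exact: csuppZ.
- move=> x; have [xe|xe] := lerP `|y - x| e.
    by rewrite ler_wpM2r ?prodf_bumps_ge0// um.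
  by rewrite prodf_bumps_eq0// !mulr0.
Qed.

Lemma mollify_ge y (u : 'rV[R]_N -> R) m :
  (forall x, `|y - x| <= e -> {for x, continuous u}) ->
  (forall x, `|y - x| <= e -> m <= u x) -> m <= mollify u y.
Proof.
move=> cu um; have M0 : 0 <= `|y| + e by rewrite addr_ge0 // ltW.
have sb := csupp_bumps y _ (lexx _).
rewrite -[leLHS]mulr1 -(integral_bumps y) -(integral_rVZ _ _ (`|y| + e))//.
apply: (integral_rV_le _ _ (`|y| + e)) => //.
- exact: csuppZ.
- exact: csupp_mul_bumps.
- move=> x; have [xe|xe] := lerP `|y - x| e.
    by rewrite ler_wpM2r ?prodf_bumps_ge0// um.
  by rewrite prodf_bumps_eq0// !mulr0.
Qed.

Lemma test_function_bumps D (y : 'rV[R]_N) : (forall x, `|y - x| <= e -> D x) ->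
  test_function D (prodf R N (bumps y)).
Proof.
move=> yD; split.
  by move=> k; apply: C_on_prodf => i; exact: smooth1_bumps.
exists [set x | `|y - x| <= e]; split=> //.
- exact: compact_norm_sub_le.
- by move=> x /= /negP; rewrite -ltNge; exact: prodf_bumps_eq0.
Qed.

Definition diff2 (w : 'rV[R]_N -> R) (h : R) (i : 'I_N) (y : 'rV[R]_N) : R :=
  w (y + h *: 'e_i) + w (y - h *: 'e_i) - 2 * w y.

(** The second difference in the centre of the bump in direction e_i only affects
the i-th factor; it is h^2 times the second derivative of that factor plus a
remainder. *)
Lemma prodf_bumps_diff2 y h i x :
  diff2 (fun z => prodf R N (bumps z) x) h i y =
  h ^+ 2 * prodf R N (upd R N (bumps y) i ((bumps y i)^`()^`()%classic)) x +
  prodf R N (upd R N (bumps y) i (fun t =>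
    bumps y i (t - h) + bumps y i (t + h) - 2 * bumps y i t
    - h ^+ 2 * (bumps y i)^`()^`()%classic t)) x.
Proof.
rewrite /diff2 !prodf_upd !(prodfD1 R N _ i).
have E (s : R) : \prod_(j | j != i) bumps (y + s *: 'e_i) j (x ord0 j) =
   \prod_(j | j != i) bumps y j (x ord0 j).
  by apply: eq_bigr => j ji; rewrite /bumps !mxE (negbTE ji) andbF mulr0 addr0.
rewrite -scaleNr !E /bumps !mxE !eqxx /= !mulr1.
have -> : x ord0 i - (y ord0 i + h) = x ord0 i - h - y ord0 i by ring.
have -> : x ord0 i - (y ord0 i - h) = x ord0 i + h - y ord0 i by ring.
ring.
Qed.

Lemma derive1_shift (f : R -> R) (c : R) : (forall t, derivable f t 1) ->
  (fun t => f (t - c))^`()%classic = (fun t => f^`()%classic (t - c)).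
Proof.
move=> df; apply/funext => t.
have dsh : is_derive t 1 (fun s : R => s - c) 1.
  by rewrite -[1 in X in is_derive _ _ _ X](addr0 1); apply: is_deriveD.
have dft : is_derive (t - c) 1 f (f^`()%classic (t - c)).
  by rewrite derive1E; apply: DeriveDef.
have := @is_derive1_comp _ f (fun s : R => s - c) t _ _ dft dsh.
by rewrite mulr1 [LHS]derive1E => -[_ <-].
Qed.

Lemma bumps_second_derivative (y : 'rV[R]_N) i :
  (bumps y i)^`()^`()%classic = (fun t => a^`()^`()%classic (t - y ord0 i)).
Proof. by rewrite /bumps !derive1_shift//; have [? []] := sa 2. Qed.

Lemma norm_shift_basis h i (s : R) : 0 <= h -> `|s| <= h ->
  `|s *: ('e_i : 'rV[R]_N)| <= h.
Proof.
move=> h0 sh; apply: norm_le_coord => // j; rewrite !mxE normrM.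
apply: le_trans sh; apply: ler_piMr => //.
by case: (_ && _); rewrite ?normr1 ?normr0.
Qed.

Lemma csupp_mul_upd (u : 'rV[R]_N -> R) y i (b : R -> R) r M :
  e <= r -> `|y| + r <= M -> (forall x, `|y - x| <= r -> {for x, continuous u}) ->
  continuous b -> (forall t, r < `|y ord0 i - t| -> b t = 0) ->
  csupp R N M (fun x => u x * prodf R N (upd R N (bumps y) i b) x).
Proof.
move=> er yM cu cb b0; have r0 : 0 <= r by move: e0; lra.
apply: (csupp_mul R N y r) => //.
- apply: continuous_prodf => j; rewrite /upd.
  by case: eqP => _ //; exact: continuous_bumps.
- move=> x; apply: prodf_supp => // j t; rewrite /upd.
  case: eqP => [->|_]; first exact: b0.
  by move=> H; apply: bumps_supp; lra.
Qed.

Lemma continuous_bumps_second_derivative (y : 'rV[R]_N) i :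
  continuous (bumps y i)^`()^`()%classic.
Proof. by have [_ [_]] := smooth1_bumps 2 y i. Qed.

Lemma bumps_second_derivative_supp (y : 'rV[R]_N) i t :
  e < `|y ord0 i - t| -> (bumps y i)^`()^`()%classic t = 0.
Proof.
move=> H; rewrite bumps_second_derivative.
apply: (derive1_support R _ e (derive1_support R a e _)); last by rewrite distrC.
by move=> s es; apply: ae; exact: ltW.
Qed.

(** The second difference of the mollified function is the integral of u against
the second difference of the bump.  Only a bound of the remainder in one
variable enters, so the error is uniform in y. *)
Lemma mollify_diff2 (u : 'rV[R]_N -> R) y i h M S A kappa : 0 < h ->
  (forall x, `|y - x| <= e + h -> {for x, continuous u}) ->
  (forall x, `|y - x| <= e + h -> `|u x| <= S) -> 0 <= S ->
  `|y| + (e + h) <= M ->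
  (forall t, `|a t| <= A) ->
  (forall t, `|a (t + h) + a (t - h) - 2 * a t - h ^+ 2 * a^`()^`()%classic t|
     <= kappa) ->
  `|diff2 (mollify u) h i y - h ^+ 2 * integral_rV (fun x => u x *
      prodf R N (upd R N (bumps y) i ((bumps y i)^`()^`()%classic)) x)|
   <= S * (kappa * A ^+ N.-1) * (2 * M) ^+ N.
Proof.
move=> h0 cu uS S0 yM aA ak.
have M0 : 0 <= M by have := normr_ge0 y; move: e0; lra.
have hn (s : R) : `|s| <= h -> `|s *: ('e_i : 'rV[R]_N)| <= h.
  by move=> sh; apply: norm_shift_basis => //; exact: ltW.
have csh (s : R) : `|s| <= h ->
    csupp R N M (fun x => u x * prodf R N (bumps (y + s *: 'e_i)) x).
  move=> sh; have hs := hn s sh; apply: csupp_mul_bumps.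
    have := ler_normD y (s *: 'e_i); lra.
  move=> x xe; apply: cu; have := ler_normB (y + s *: 'e_i - x) (s *: 'e_i).
  rewrite (_ : _ + _ - x - _ = y - x); first lra.
  by rewrite addrAC addrK.
have eh : e <= e + h by rewrite lerDl ltW.
have cb2 := continuous_bumps_second_derivative y i.
have csh2 (s : R) : continuous (fun t => bumps y i (t + s)).
  move=> t; apply: (@continuous_comp _ _ _ (fun t : R => t + s)).
    by apply: continuousD; [exact: cvg_id|exact: cst_continuous].
  exact: continuous_bumps.
pose er (t : R) := bumps y i (t - h) + bumps y i (t + h) - 2 * bumps y i t
    - h ^+ 2 * (bumps y i)^`()^`()%classic t.
have cer : continuous er.
  move=> t; apply: (@continuousB _ _ _
    (fun t => bumps y i (t - h) + bumps y i (t + h) - 2 * bumps y i t)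
    (fun t => h ^+ 2 * (bumps y i)^`()^`()%classic t)).
    apply: (@continuousB _ _ _ (fun t => bumps y i (t - h) + bumps y i (t + h))
        (fun t => 2 * bumps y i t)).
      by apply: (@continuousD _ _ _ (fun t => bumps y i (t - h))); exact: csh2.
    apply: (@continuousM _ _ (cst 2)); first exact: cst_continuous.
    exact: continuous_bumps.
  by apply: (@continuousM _ _ (cst (h ^+ 2))); [exact: cst_continuous|exact: cb2].
have er0 t : e + h < `|y ord0 i - t| -> er t = 0.
  move=> H; have H0 : e < `|t - y ord0 i| by rewrite distrC; lra.
  have H1 : e < `|t - h - y ord0 i|.
    rewrite distrC; have := ler_normB (y ord0 i - (t - h)) h.
    by rewrite (gtr0_norm h0) (_ : _ - _ - h = y ord0 i - t); [lra|ring].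
  have H2 : e < `|t + h - y ord0 i|.
    rewrite distrC; have := ler_normD (y ord0 i - (t + h)) h.
    by rewrite (gtr0_norm h0) (_ : _ - _ + h = y ord0 i - t); [lra|ring].
  rewrite /er bumps_second_derivative_supp 1?distrC// /bumps !ae ?ltW//; ring.
have ce := csupp_mul_upd u y i er (e + h) M eh yM cu cer er0.
have c2 : csupp R N M (fun x => u x *
    prodf R N (upd R N (bumps y) i ((bumps y i)^`()^`()%classic)) x).
  apply: (csupp_mul_upd u y i _ (e + h)) => // t H.
  by apply: bumps_second_derivative_supp; move: h0; lra.
have E : diff2 (mollify u) h i y = h ^+ 2 * integral_rV (fun x => u x *
      prodf R N (upd R N (bumps y) i ((bumps y i)^`()^`()%classic)) x) +
    integral_rV (fun x => u x * prodf R N (upd R N (bumps y) i er) x).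
  rewrite -(integral_rVZ _ _ M)// -(integral_rVD _ _ M)//; last exact: csuppZ.
  rewrite /diff2 /mollify.
  have cp := csh h _; have cm := csh (- h) _; have c0 := csh 0 _.
  rewrite -scaleNr -mulNr.
  have {}cp : csupp R N M (fun x => u x * prodf R N (bumps (y + h *: 'e_i)) x).
    by apply: cp; rewrite gtr0_norm.
  have {}cm : csupp R N M (fun x => u x * prodf R N (bumps (y + (- h) *: 'e_i)) x).
    by apply: cm; rewrite normrN gtr0_norm.
  have {}c0 : csupp R N M (fun x => u x * prodf R N (bumps y) x).
    by move: c0; rewrite scale0r addr0; apply; rewrite normr0 ltW.
  rewrite -(integral_rVZ _ _ M)// -(integral_rVD _ _ M)// -(integral_rVD _ _ M)//.
  - congr integral_rV; apply/funext => x.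
    have := congr1 (fun z => u x * z) (prodf_bumps_diff2 y h i x).
    by rewrite /diff2 -scaleNr -/er; lra.
  - exact: csuppD.
  - exact: csuppZ.
rewrite E addrAC subrr add0r.
apply: (integral_rV_lin_bound R N M M0).1 => // x.
have [xe|xe] := lerP `|y - x| (e + h); last first.
  have -> : prodf R N (upd R N (bumps y) i er) x = 0.
    apply: (prodf_supp R N _ y x (e + h)) => //; first by rewrite addr_ge0 // ltW.
    move=> j t; rewrite /upd; case: eqP => [->|_]; first exact: er0.
    by move=> H; apply: bumps_supp; move: h0; lra.
  rewrite mulr0 normr0; apply: mulr_ge0 => //; apply: mulr_ge0.
    exact: le_trans (ak 0).
  by apply: exprn_ge0; exact: le_trans (aA 0).
rewrite normrM ler_pM ?uS// prodf_upd normrM ler_pM//.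
  have := ak (x ord0 i - y ord0 i); rewrite /er bumps_second_derivative /bumps.
  rewrite (_ : x ord0 i - y ord0 i + h = x ord0 i + h - y ord0 i); last by ring.
  rewrite (_ : x ord0 i - y ord0 i - h = x ord0 i - h - y ord0 i); last by ring.
  by rewrite [X in `|X - _ - _|]addrC.
rewrite normr_prod.
have -> : A ^+ N.-1 = \prod_(j | j != i) A.
  by rewrite prodr_const cardC1 card_ord.
by apply: ler_prod => j _; rewrite normr_ge0 aA.
Qed.

Lemma laplacian_bumps (y x : 'rV[R]_N) : laplacian (prodf R N (bumps y)) x =
  \sum_i prodf R N (upd R N (bumps y) i ((bumps y i)^`()^`()%classic)) x.
Proof. by apply: laplacian_prodf => i; exact: smooth1_bumps. Qed.

(** Summed over the directions, the main terms form the integral of u against the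
Laplacian of a test function, and the equation replaces it by the mean of v.
This is the only use of the distributional equation. *)
Lemma sum_mollify_diff2 (D : set 'rV[R]_N) (u v : 'rV[R]_N -> R) y h M S A kappa m :
  open D -> (forall x, D x -> {for x, continuous u}) ->
  (forall x, D x -> {for x, continuous v}) -> distr_laplacian_eq D u v ->
  0 < h -> (forall x, `|y - x| <= e + h -> D x) ->
  (forall x, `|y - x| <= e + h -> `|u x| <= S) ->
  (forall x, `|y - x| <= e + h -> m <= v x) ->
  0 <= S -> `|y| + (e + h) <= M ->
  (forall t, `|a t| <= A) ->
  (forall t, `|a (t + h) + a (t - h) - 2 * a t - h ^+ 2 * a^`()^`()%classic t|
     <= kappa) ->
  h ^+ 2 * m - N%:R * (S * (kappa * A ^+ N.-1) * (2 * M) ^+ N) <=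
  \sum_i diff2 (mollify u) h i y.
Proof.
move=> oD cu cv uv h0 yD uS vm S0 yM aA ak.
have M0 : 0 <= M by have := normr_ge0 y; move: e0; lra.
have yeD x : `|y - x| <= e -> D x by move=> H; apply: yD; move: h0; lra.
pose I i := integral_rV (fun x => u x *
      prodf R N (upd R N (bumps y) i ((bumps y i)^`()^`()%classic)) x).
have HI i : h ^+ 2 * I i - S * (kappa * A ^+ N.-1) * (2 * M) ^+ N <=
    diff2 (mollify u) h i y.
  have := mollify_diff2 u y i h M S A kappa h0
    (fun x H => cu x (yD x H)) uS S0 yM aA ak.
  by rewrite ler_norml -/(I i) => /andP[+ _]; lra.
have sumI : \sum_i I i = mollify v y.
  rewrite /mollify -(uv _ (test_function_bumps D y yeD)).
  rewrite -(integral_rV_sum _ _ M)//; last first.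
    move=> i; apply: (csupp_mul_upd u y i _ (e + h)) => //.
    - by rewrite lerDl ltW.
    - by move=> x H; apply: cu; exact: yD.
    - exact: continuous_bumps_second_derivative.
    - by move=> t H; apply: bumps_second_derivative_supp; move: h0; lra.
  congr integral_rV; apply/funext => x.
  by rewrite laplacian_bumps mulr_sumr.
have mv : m <= mollify v y.
  apply: mollify_ge => x xe; first by apply: cv; exact: yeD.
  by apply: vm; move: h0; lra.
apply: (@le_trans _ _
  (\sum_i (h ^+ 2 * I i - S * (kappa * A ^+ N.-1) * (2 * M) ^+ N))).
  rewrite sumrB -mulr_sumr sumI sumr_const card_ord -[X in _ <= _ - X]mulr_natl.
  by rewrite lerD2r ler_wpM2l // exprn_ge0 // ltW.
by apply: ler_sum => i _; exact: HI.
Qed.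
End mollification.

(** * Comparison of weak solutions with barriers *)

Lemma compact_support_bounded (R : realType) (a : R -> R) (e : R) : 0 < e ->
  continuous a -> (forall t, e <= `|t| -> a t = 0) ->
  exists A, forall t, `|a t| <= A.
Proof.
move=> e0 ca ae.
have [] := @EVT_max R (fun t => `|a t|) (- e) e.
- by move: e0; lra.
- by apply: continuous_subspaceT => t; apply: cvg_norm; exact: ca.
move=> c _ cmax; exists `|a c| => t; have [te|te] := lerP `|t| e.
  by apply: cmax; rewrite in_itv /= -ler_norml.
by rewrite ae ?normr0 // ltW.
Qed.

(** Mollifying u at a scale e much smaller than r displaces the maximum of u - W
only a little, thanks to strictness.  At a point y where the mollified u minus W
is within tau of its supremum over the ball of radius r, all second differences
of that function are at most 2 tau; but their sum is at least theta h^2 up to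
o(h^2), by the equation for u and the bound for W.  Working with an almost
maximum avoids any regularity of the mollified function. *)
Lemma no_strict_max (R : realType) (N : nat) (D : set 'rV[R]_N)
    (u v W : 'rV[R]_N -> R) (x1 : 'rV[R]_N) (r k m theta h0 S : R) :
  open D -> (forall x, D x -> {for x, continuous u}) ->
  (forall x, D x -> {for x, continuous v}) -> distr_laplacian_eq D u v ->
  continuous W -> 0 < r -> 0 < k -> 0 < theta -> 0 < h0 ->
  (forall x, `|x1 - x| <= 2 * r -> D x) ->
  (forall x, `|x1 - x| <= 2 * r -> `|u x| <= S) ->
  (forall x, `|x1 - x| <= 2 * r -> m <= v x) ->
  (forall y h, `|x1 - y| <= r -> 0 < h -> h < h0 ->
     \sum_i diff2 R N W h i y <= h ^+ 2 * (m - theta)) ->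
  (forall x, `|x1 - x| <= 2 * r ->
     u x - W x <= u x1 - W x1 - k * `|x1 - x| ^+ 2) -> False.
Proof.
move=> oD cu cv uv cW r0 k0 th0 h00 rD uS vm WD umax.
have tri (x y z : 'rV[R]_N) : `|x - z| <= `|x - y| + `|y - z|.
  by have := ler_normD (x - y) (y - z); rewrite addrA subrK.
(* On the annulus |x1 - x| >= r / 4 the strict maximum leaves a margin 4 gam, of
which gam is spent on each of the oscillations of u and W and on tau. *)
pose gam := k * (r / 4) ^+ 2 / 4.
have r40 : 0 < r / 4 by rewrite divr_gt0.
have gam0 : 0 < gam by rewrite divr_gt0 // mulr_gt0 // exprn_gt0.
have [dW dW0 HW] := compact_uniform_continuity R _ _ W
  (compact_norm_sub_le R N x1 (2 * r)) (fun x _ => cW x) gam gam0.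
have Dx1 : D x1 by apply: rD; rewrite subrr normr0 mulr_ge0 // ltW.
have [du du0 Hu] := (continuous_distP R _ u x1).1 (cu x1 Dx1) gam gam0.
pose e := Num.min (Num.min dW du) (r / 4) / 2.
have min0 : 0 < Num.min (Num.min dW du) (r / 4) by rewrite !lt_min dW0 du0 r40.
have e0 : 0 < e by rewrite divr_gt0.
have eM : e < Num.min (Num.min dW du) (r / 4) by rewrite /e; lra.
have [edW edu er] : [/\ e < dW, e < du & e < r / 4].
  by move: eM; rewrite !lt_min => /andP[/andP[]].
have [a [sa a0 ae a1]] := exists_mollifier R e e0.
have ca : continuous a := smooth1_continuous R 0 a (sa 0).
have [A aA] := compact_support_bounded R a e e0 ca ae.
pose Q := mollify R N a u.
pose V y := Q y - W y.
have cuB y : `|x1 - y| <= r -> forall x, `|y - x| <= e -> {for x, continuous u}.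
  move=> yr x xe; apply/cu/rD; have := tri x1 y x; lra.
have V1 : u x1 - W x1 - gam <= V x1.
  suff : u x1 - gam <= Q x1 by rewrite /V; lra.
  apply: (mollify_ge R N a e) => //; first by apply: cuB; rewrite subrr normr0 ltW.
  move=> x xe; have := Hu x (le_lt_trans xe edu).
  by rewrite ler_norml => /andP[_]; lra.
have Vup y c : `|x1 - y| <= r ->
    (forall x, `|y - x| <= e -> u x - W x <= c) -> V y <= c + gam.
  move=> yr H; suff : Q y <= W y + c + gam by rewrite /V; lra.
  apply: (mollify_le R N a e) => //; first exact: cuB.
  move=> x xe; have yr2 : `|x1 - y| <= 2 * r by lra.
  have := HW y x yr2 (le_lt_trans xe edW); have := H x xe.
  by rewrite ler_norml => ? /andP[+ _]; lra.
have V2 y : `|x1 - y| <= r -> V y <= u x1 - W x1 + gam.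
  move=> yr; apply: Vup => // x xe.
  have x2r : `|x1 - x| <= 2 * r by have := tri x1 y x; lra.
  have := umax x x2r; have : 0 <= k * `|x1 - x| ^+ 2.
    by rewrite mulr_ge0 ?exprn_ge0// ltW.
  lra.
have V3 y : r / 2 <= `|x1 - y| -> `|x1 - y| <= r -> V y <= u x1 - W x1 - 3 * gam.
  move=> ry yr; rewrite (_ : _ - 3 * gam = (u x1 - W x1 - k * (r / 4) ^+ 2) + gam).
    apply: Vup => // x xe.
    have x2r : `|x1 - x| <= 2 * r by have := tri x1 y x; lra.
    have xr4 : r / 4 <= `|x1 - x| by have := tri x1 x y; rewrite [`|x - y|]distrC; lra.
    have := umax x x2r; have : k * (r / 4) ^+ 2 <= k * `|x1 - x| ^+ 2.
      rewrite ler_wpM2l ?(ltW k0)// ler_pXn2r// ?nnegrE ?normr_ge0//; exact: ltW.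
    lra.
  by rewrite /gam; lra.
have S0 : 0 <= S.
  apply: le_trans (uS x1 _); first exact: normr_ge0.
  by rewrite subrr normr0 mulr_ge0 // ltW.
pose M := `|x1| + 2 * r.
have M0 : 0 <= M by have := normr_ge0 x1; rewrite /M; lra.
pose C := N%:R * (S * A ^+ N.-1 * (2 * M) ^+ N).
have A0 : 0 <= A by exact: le_trans (aA 0).
have C0 : 0 <= C.
  by rewrite /C !mulr_ge0 ?ler0n ?exprn_ge0// mulr_ge0.
(* With this precision the mollification error is at most theta h^2 / 4. *)
pose kappa := theta / (4 * (C + 1)).
have C40 : 0 < 4 * (C + 1) by lra.
have kap0 : 0 < kappa by rewrite divr_gt0.
have aeS t : e < `|t| -> a t = 0 by move=> et; apply: ae; exact: ltW.
have [da da0 Hda] := second_difference_uniform R a e (sa 2) aeS kappa kap0.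
pose h := Num.min (Num.min h0 da) (r / 2) / 2.
have hm0 : 0 < Num.min (Num.min h0 da) (r / 2) by rewrite !lt_min h00 da0 divr_gt0.
have hp : 0 < h by rewrite divr_gt0.
have hM : h < Num.min (Num.min h0 da) (r / 2) by rewrite /h; lra.
have [hh0 hda hr] : [/\ h < h0, h < da & h < r / 2].
  by move: hM; rewrite !lt_min => /andP[/andP[]].
have h2 : 0 < h ^+ 2 by rewrite exprn_gt0.
(* The N second differences are at most 2 tau each, in total at most
theta h^2 / 2, which is less than the remaining 3 theta h^2 / 4. *)
pose tau := Num.min gam (theta * h ^+ 2 / (4 * (N%:R + 1))).
have N1 : 0 < 4 * (N%:R + 1) :> R by rewrite mulr_gt0 // ltr_wpDl.
have tau0 : 0 < tau by rewrite lt_min gam0 divr_gt0 // mulr_gt0.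
have taug : tau <= gam by rewrite ge_min lexx.
have tauN : N%:R * tau <= theta * h ^+ 2 / 4.
  have : tau <= theta * h ^+ 2 / (4 * (N%:R + 1)) by rewrite ge_min lexx orbT.
  rewrite ler_pdivlMr // => H; have := ltW tau0; lra.
pose E := [set V y | y in [set y | `|x1 - y| <= r]].
have Ex1 : E (V x1) by exists x1 => //=; rewrite subrr normr0 ltW.
have hsE : has_sup E.
  split; first by exists (V x1).
  by exists (u x1 - W x1 + gam) => _ [y /= yr <-]; exact: V2.
have [_ [y /= yr <-] yE] := sup_adherent tau0 hsE.
have supV z : `|x1 - z| <= r -> V z <= V y + tau.
  move=> zr; have EVz : E (V z) by exists z.
  have := sup_upper_bound hsE EVz; lra.
have yr2 : `|x1 - y| < r / 2.
  rewrite ltNge; apply/negP => ry; have := V3 y ry yr.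
  have := supV x1; rewrite subrr normr0 => /(_ (ltW r0)); lra.
have sh i (s : R) : `|s| <= h -> `|x1 - (y + s *: 'e_i)| <= r.
  move=> sh; have := norm_shift_basis R N h i s (ltW hp) sh.
  have := ler_normB (x1 - y) (s *: 'e_i); rewrite opprD addrA; lra.
have dV i : diff2 R N Q h i y <= diff2 R N W h i y + 2 * tau.
  have Vp : V (y + h *: 'e_i) <= V y + tau by apply/supV/sh; rewrite gtr0_norm.
  have Vm : V (y - h *: 'e_i) <= V y + tau.
    by rewrite -scaleNr; apply/supV/sh; rewrite normrN gtr0_norm.
  by move: Vp Vm; rewrite /V /diff2; lra.
have SQ : \sum_i diff2 R N Q h i y <= h ^+ 2 * (m - theta) + 2 * (N%:R * tau).
  apply: (@le_trans _ _ (\sum_i (diff2 R N W h i y + 2 * tau))).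
    by apply: ler_sum => i _; exact: dV.
  rewrite big_split /= sumr_const card_ord -[X in _ + X <= _]mulr_natl mulrCA.
  by rewrite lerD2r; exact: WD.
have yx x : `|y - x| <= e + h -> `|x1 - x| <= 2 * r.
  by move=> H; have := tri x1 y x; lra.
have yM : `|y| + (e + h) <= M.
  have := ler_normB x1 (x1 - y); rewrite opprB addrC subrK /M; lra.
have := sum_mollify_diff2 R N a e e0 sa a0 ae a1 D u v y h M S A (kappa * h ^+ 2) m
  oD cu cv uv hp (fun x H => rD x (yx x H)) (fun x H => uS x (yx x H))
  (fun x H => vm x (yx x H)) S0 yM aA (Hda h hp hda).
rewrite -/Q.
have -> : N%:R * (S * (kappa * h ^+ 2 * A ^+ N.-1) * (2 * M) ^+ N) =
    C * kappa * h ^+ 2.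
  by rewrite /C; ring.
have Ck : C * kappa <= theta / 4.
  rewrite /kappa mulrA ler_pdivrMr //.
  have := ltW th0; have := C0; nra.
have Ckh : C * kappa * h ^+ 2 <= theta / 4 * h ^+ 2 by rewrite ler_wpM2r // ltW.
have : 0 < theta * h ^+ 2 by rewrite mulr_gt0.
lra.
Qed.

Definition sqdist (R : realType) (N : nat) (b x : 'rV[R]_N) : R :=
  \sum_i (x ord0 i - b ord0 i) ^+ 2.

Lemma sqdist_ge0 (R : realType) N (b x : 'rV[R]_N) : 0 <= sqdist R N b x.
Proof. by apply: sumr_ge0 => i _; exact: sqr_ge0. Qed.

Lemma continuous_sum_coord (R : realType) N (f : 'I_N -> R -> R) :
  (forall i, continuous (f i)) ->
  continuous (fun x : 'rV[R]_N => \sum_i f i (x ord0 i)).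
Proof.
move=> cf; elim: (index_enum _) => [|i s IH] x.
  by under eq_fun do rewrite big_nil; exact: cst_continuous.
under eq_fun do rewrite big_cons.
apply: (@continuousD _ _ _ (fun x : 'rV[R]_N => f i (x ord0 i))); last exact: IH.
by apply: (@continuous_comp _ _ _ (fun x : 'rV[R]_N => x ord0 i));
  [exact: continuous_coord|exact: cf].
Qed.

Lemma continuous_sqdist (R : realType) N (b : 'rV[R]_N) :
  continuous (sqdist R N b).
Proof.
apply: (continuous_sum_coord R N (fun i t => (t - b ord0 i) ^+ 2)) => i t.
apply: (@continuous_comp _ _ _ (fun t : R => t - b ord0 i) (fun t => t ^+ 2)).
  by apply: continuousB; [exact: cvg_id|exact: cst_continuous].
exact: exprn_continuous.
Qed.

(** Norms of row vectors are maximum norms, hence bounded by the Euclidean one. *)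
Lemma norm_sqdist (R : realType) N (b x : 'rV[R]_N) :
  `|b - x| ^+ 2 <= sqdist R N b x.
Proof.
have s0 := sqdist_ge0 R N b x.
rewrite -(sqr_sqrtr s0) ler_pXn2r ?nnegrE ?sqrtr_ge0//.
apply: norm_le_coord => [|i]; first exact: sqrtr_ge0.
rewrite !mxE -sqrtr_sqr ler_sqrt // /sqdist (bigD1 i)//= -[leLHS]addr0 lerD//.
  by rewrite -[leLHS]sqrrN opprB.
by apply: sumr_ge0 => j _; exact: sqr_ge0.
Qed.

Lemma sum_diff2_sqdist (R : realType) N (b : 'rV[R]_N) h y :
  \sum_i diff2 R N (sqdist R N b) h i y = 2 * N%:R * h ^+ 2.
Proof.
have E i : diff2 R N (sqdist R N b) h i y = 2 * h ^+ 2.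
  have S (s : R) : sqdist R N b (y + s *: 'e_i) = (y ord0 i + s - b ord0 i) ^+ 2 +
     \sum_(j | j != i) (y ord0 j - b ord0 j) ^+ 2.
    rewrite /sqdist (bigD1 i)//= !mxE !eqxx /= mulr1; congr (_ + _).
    by apply: eq_bigr => j ji; rewrite !mxE (negbTE ji) andbF mulr0 addr0.
  by have := S 0; rewrite scale0r !addr0 /diff2 -scaleNr !S => ->; ring.
under eq_bigr do rewrite E.
by rewrite sumr_const card_ord -mulr_natl; ring.
Qed.

Lemma compact_closure_bounded (R : realType) N (D : set 'rV[R]_N) :
  bounded_set D -> compact (closure D).
Proof.
move=> [M0 [_ bD]].
have DM : D `<=` [set x : 'rV[R]_N | `|0 - x| <= M0 + 1].
  by move=> x Dx; rewrite /= sub0r normrN; apply: bD => //; rewrite ltrDl.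
apply: subclosed_compact (compact_norm_sub_le R N 0 (M0 + 1)) _.
  exact: closed_closure.
have cK : closed [set x : 'rV[R]_N | `|0 - x| <= M0 + 1].
  exact: compact_closed (@norm_hausdorff _ _) (compact_norm_sub_le R N 0 (M0 + 1)).
by move/closure_id: cK => ->; exact: closureS.
Qed.

(** For eta small compared with v x0, the perturbation cannot move the maximum of
v to the boundary, where v <= 0, nor to a point where v <= 0. *)
Lemma perturbed_max (R : realType) N (D : set 'rV[R]_N) (v : 'rV[R]_N -> R) x0 :
  open D -> bounded_set D -> {within closure D, continuous v} ->
  (forall x, boundary D x -> v x <= 0) -> D x0 -> 0 < v x0 ->
  exists eta x1, [/\ 0 < eta, D x1, 0 < v x1 &
    forall x, D x -> v x + eta * sqdist R N x0 x <= v x1 + eta * sqdist R N x0 x1].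
Proof.
move=> oD bD cv vb Dx0 vx0.
have cD := compact_closure_bounded R N D bD.
have nD : closure D !=set0 by exists x0; exact: subset_closure.
have cq : {within closure D, continuous (sqdist R N x0)}.
  by apply: continuous_subspaceT; exact: continuous_sqdist.
have [c _ cmax] := EVT_max_rV nD cD cq.
set P := sqdist R N x0 c in cmax.
have P0 : 0 <= P := sqdist_ge0 R N x0 c.
have P1 : 0 < 2 * (P + 1) by lra.
pose eta := v x0 / (2 * (P + 1)).
have eta0 : 0 < eta by rewrite divr_gt0.
have etaP : eta * P <= v x0 / 2.
  by rewrite /eta mulrAC ler_pdivrMr//; nra.
have cF : {within closure D, continuous (fun x => v x + eta * sqdist R N x0 x)}.
  move=> x; apply: (@continuousD _ _ (subspace (closure D)) v
     (fun x => eta * sqdist R N x0 x)); first exact: cv.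
  apply: (@continuousM _ (subspace (closure D)) (cst eta) (sqdist R N x0)).
    exact: cst_continuous.
  exact: cq.
have [x1 /set_mem cx1 x1max] := EVT_max_rV nD cD cF.
have x00 : sqdist R N x0 x0 = 0.
  by rewrite /sqdist big1 // => i _; rewrite subrr expr0n.
have v1 : v x0 <= v x1 + v x0 / 2.
  have := x1max x0 (mem_set (subset_closure Dx0)); rewrite x00 mulr0 addr0.
  have : eta * sqdist R N x0 x1 <= eta * P.
    by rewrite ler_wpM2l ?(ltW eta0)// cmax // mem_set.
  lra.
have Dx1 : D x1.
  apply: contrapT => nDx1; have := vb x1 (conj cx1 _).
  rewrite (_ : interior D = D) => [/(_ nDx1)|]; first lra.
  by rewrite -interior_id.
exists eta, x1; split=> //; first by lra.
by move=> x Dx; apply: x1max; apply/mem_set/subset_closure.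
Qed.

Lemma within_closure_continuous (R : realType) N (D : set 'rV[R]_N)
   (u : 'rV[R]_N -> R) : open D -> {within closure D, continuous u} ->
   forall x, D x -> {for x, continuous u}.
Proof.
move=> oD cu x Dx.
have := continuous_subspaceW (@subset_closure _ D) cu.
by rewrite continuous_open_subspace// => /(_ x (mem_set Dx)).
Qed.

Lemma within_nonneg_continuous (R : realType) (phi : R -> R) :
  {within `[0, +oo[, continuous phi} -> forall t, 0 <= t -> forall e, 0 < e ->
  exists2 d, 0 < d & forall s, 0 <= s -> `|t - s| < d -> `|phi t - phi s| <= e.
Proof.
move=> /continuous_within_itvcyP[cphi phi0] t t0 e e0.
move: t0; rewrite le_eqVlt => /predU1P[<-|t0].
  have /cvgrPdist_le/(_ _ e0) [d /= d0 H] := phi0.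
  exists d => // s; rewrite le_eqVlt => /predU1P[<- _|s0 sd].
    by rewrite subrr normr0 ltW.
  exact: H.
have ct : {for t, continuous phi} by apply: cphi; rewrite in_itv /= t0.
have [d d0 H] := (continuous_distP R _ phi t).1 ct e e0.
by exists d => // s _; exact: H.
Qed.

(** The hypothesis on second differences expresses Delta w <= 2 phi(w) without
derivatives; sigma leaves room for the values of w at the neighbouring points.
At an interior maximum x1 of u - w + eta |x - x0|^2 with u x1 > w x1, the
functions u and w are separated near x1 by a constant s, so that phi(u) >= phi(s)
and phi(w + sigma) <= phi(s) there. *)
Lemma comparison (R : realType) (N : nat) (D : set 'rV[R]_N) (phi : R -> R)
    (u w : 'rV[R]_N -> R) :
  (0 < N)%N -> open D -> bounded_set D ->
  {within `[0, +oo[, continuous phi} ->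
  (forall r s : R, 0 <= r -> r <= s -> phi r <= phi s) ->
  {within closure D, continuous u} -> (forall x, closure D x -> 0 <= u x) ->
  distr_laplacian_eq D u (fun x => 2 * phi (u x)) ->
  continuous w -> (forall x, 0 <= w x) ->
  (forall sigma, 0 < sigma -> exists2 h0, 0 < h0 & forall h y, 0 < h -> h < h0 ->
     \sum_i diff2 R N w h i y <= 2 * h ^+ 2 * phi (w y + sigma)) ->
  (forall x, boundary D x -> u x <= w x) ->
  forall x, D x -> u x <= w x.
Proof.
move=> N0 oD bD cphi ndphi cu u0 uphi cw w0 wD uw x0 Dx0.
rewrite leNgt; apply/negP => wu0.
have cuD := within_closure_continuous R N D u oD cu.
have cv : {within closure D, continuous (fun x => u x - w x)}.
  move=> x; apply: (@continuousB _ _ (subspace (closure D)) u w); first exact: cu.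
  by apply: continuous_subspaceT x => x; exact: cw.
have vb x : boundary D x -> u x - w x <= 0 by move=> /uw; rewrite subr_le0.
have v0 : 0 < u x0 - w x0 by rewrite subr_gt0.
have [eta [x1 [eta0 Dx1 v1 vmax]]] := perturbed_max R N D _ x0 oD bD cv vb Dx0 v0.
pose sig := (u x1 - w x1) / 4.
have sig0 : 0 < sig by rewrite divr_gt0.
have sigE : u x1 = w x1 + 4 * sig by rewrite /sig; lra.
have [h0 h00 Hw] := wD sig sig0.
have [d1 d10 Hu] := (continuous_distP R _ u x1).1 (cuD x1 Dx1) sig sig0.
have [d2 d20 Hw1] := (continuous_distP R _ w x1).1 (cw x1) sig sig0.
have [d3 d30 HD] : exists2 d, 0 < d & forall x, `|x1 - x| < d -> D x.
  have /nbhs_ballP[d /= d0 H] : nbhs x1 D by exact: open_nbhs_nbhs.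
  by exists d => // x xd; apply: H; rewrite -ball_normE.
pose r := Num.min (Num.min d1 d2) d3 / 4.
have r0 : 0 < r by rewrite divr_gt0 // !lt_min d10 d20 d30.
have r2 x : `|x1 - x| <= 2 * r ->
    [/\ `|x1 - x| < d1, `|x1 - x| < d2 & `|x1 - x| < d3].
  move=> xr; have : `|x1 - x| < Num.min (Num.min d1 d2) d3.
    by move: r0; rewrite /r in xr *; lra.
  by rewrite !lt_min => /andP[/andP[]].
(* The second quadratic term makes the maximum at x1 strict and costs only half
of the gain in the second differences. *)
pose W x := w x + (- eta * sqdist R N x0 x + eta / 2 * sqdist R N x1 x).
have cW : continuous W.
  move=> x; apply: (@continuousD _ _ _ w); first exact: cw.
  apply: (@continuousD _ _ _ (fun x => - eta * sqdist R N x0 x)).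
    apply: (@continuousM _ _ (cst (- eta))); first exact: cst_continuous.
    exact: continuous_sqdist.
  apply: (@continuousM _ _ (cst (eta / 2))); first exact: cst_continuous.
  exact: continuous_sqdist.
have cphiu x : D x -> {for x, continuous (fun x => 2 * phi (u x))}.
  move=> Dx; apply: (@continuousM _ _ (cst 2) (phi \o u)); first exact: cst_continuous.
  apply/continuous_distP => e e0.
  have ux0 := u0 x (subset_closure Dx).
  have [d d0 H] := within_nonneg_continuous R phi cphi (u x) ux0 e e0.
  have d20' : 0 < d / 2 by rewrite divr_gt0.
  have [d' d'0 H'] := (continuous_distP R _ u x).1 (cuD x Dx) (d / 2) d20'.
  have /nbhs_ballP[d'' /= d''0 H''] : nbhs x D by exact: open_nbhs_nbhs.
  exists (Num.min d' d''); first by rewrite lt_min d'0.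
  move=> y; rewrite lt_min => /andP[yd' yd'']; apply: H.
    by apply: u0; apply: subset_closure; apply: H''; rewrite -ball_normE.
  by apply: le_lt_trans (H' y yd') _; lra.
have th0 : 0 < N%:R * eta by rewrite mulr_gt0 // ltr0n.
apply: (no_strict_max R N D u (fun x => 2 * phi (u x)) W x1 r (eta / 2)
  (2 * phi (w x1 + 2 * sig)) (N%:R * eta) h0 (`|u x1| + sig)) => //.
- by rewrite divr_gt0.
- by move=> x /r2[_ _]; exact: HD.
- move=> x /r2[/Hu xu _ _]; have := ler_normB (u x1) (u x1 - u x).
  by rewrite opprB addrC subrK; lra.
- move=> x /r2[/Hu xu _ _]; rewrite ler_pM2l //; apply: ndphi.
    by have := w0 x1; move: sig0; lra.
  by move: xu; rewrite ler_norml sigE => /andP[_]; lra.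
- move=> y h yr hp hh0.
  have -> : \sum_i diff2 R N W h i y =
      \sum_i diff2 R N w h i y - N%:R * eta * h ^+ 2.
    have -> : N%:R * eta * h ^+ 2 =
      eta * (2 * N%:R * h ^+ 2) - eta / 2 * (2 * N%:R * h ^+ 2) by field.
    rewrite -{1}(sum_diff2_sqdist R N x0 h y) -(sum_diff2_sqdist R N x1 h y).
    rewrite !mulr_sumr -sumrB -sumrB; apply: eq_bigr => i _.
    by rewrite /diff2 /W; ring.
  have yr2 : `|x1 - y| <= 2 * r by move: r0; lra.
  have [_ /Hw1 yw _] := r2 y yr2.
  have := Hw h y hp hh0.
  have ph : phi (w y + sig) <= phi (w x1 + 2 * sig).
    apply: ndphi; first by have := w0 y; move: sig0; lra.
    by move: yw; rewrite ler_norml => /andP[? _]; lra.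
  have := ler_wpM2l (exprn_ge0 2 (ltW hp)) ph; lra.
- move=> x /r2[_ _ /HD Dx].
  have := vmax x Dx; have x11 : sqdist R N x1 x1 = 0.
    by rewrite /sqdist big1 // => i _; rewrite subrr expr0n.
  have := ler_wpM2l (ltW eta0) (norm_sqdist R N x1 x).
  by rewrite /W x11; lra.
Qed.

(** * The profile of a dead core *)

(** The integral of a nonnegative function is a supremum over simple functions
below it, so monotonicity holds without measurability.  It spares the
measurability of extended real integrands. *)
Lemma ge0_le_integral_nonmeasurable d (T : measurableType d) (R : realType)
    (mu : {measure set T -> \bar R}) (f g : T -> \bar R) :
  (forall x, 0 <= f x)%E -> (forall x, f x <= g x)%E ->
  (\int[mu]_x f x <= \int[mu]_x g x)%E.
Proof.
move=> f0 fg; have g0 x : (0 <= g x)%E by exact: le_trans (fg x).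
rewrite !ge0_integralTE//; apply: ereal_sup_le => _ [h hf <-].
by exists h => // x; exact: le_trans (fg x).
Qed.

Section increments.
Variables (R : realType) (f : R -> R) (c : R).
Hypothesis intf : (@lebesgue_measure R).-integrable `[0, c] (EFin \o f).

Definition primitive (s : R) : R := \int[@lebesgue_measure R]_(t in `[0, s]) f t.

Lemma primitive0 : primitive 0 = 0.
Proof. by rewrite /primitive set_itv1 Rintegral_set1. Qed.

Lemma primitive_lt0 s : s < 0 -> primitive s = 0.
Proof.
by move=> s0; rewrite /primitive set_itv_ge ?Rintegral_set0// bnd_simp -ltNge.
Qed.

Lemma integrable_sub b : b <= c ->
  (@lebesgue_measure R).-integrable `[0, b] (EFin \o f).
Proof.
move=> bc; apply: integrableS intf => //; apply: subset_itvl; by rewrite bnd_simp.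
Qed.

Lemma primitive_increment a b : 0 <= a -> a <= b -> b <= c ->
  (forall lo, (forall t, a < t -> t <= b -> lo <= f t) ->
     lo * (b - a) <= primitive b - primitive a) /\
  (forall hi, (forall t, a < t -> t <= b -> f t <= hi) ->
     primitive b - primitive a <= hi * (b - a)).
Proof.
move=> a0 ab bc.
have ib := integrable_sub b bc.
rewrite /primitive Rintegral_itvB//.
have iab : (@lebesgue_measure R).-integrable `]a, b] (EFin \o f).
  by apply: integrableS ib => //; apply: subset_itvr; rewrite bnd_simp.
have icst r : (@lebesgue_measure R).-integrable `]a, b] (EFin \o cst r).
  have : (@lebesgue_measure R).-integrable `[a, b] (EFin \o cst r).
    by apply: continuous_itv_integrable => t; exact: cvg_cst.
  by apply: integrableS => //; apply: subset_itvr; rewrite bnd_simp.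
have E r : \int[@lebesgue_measure R]_(t in `]a, b]) (cst r t) = r * (b - a).
  rewrite Rintegral_cst //= lebesgue_measure_itv /= lte_fin.
  case: ltP => //= ba; have -> : a = b by apply/eqP; rewrite eq_le ab.
  by rewrite subrr.
split=> r fr; rewrite -!E; apply: le_Rintegral => // t /=; rewrite in_itv /=;
  by move=> /andP[ta tb]; exact: fr.
Qed.
End increments.

Section osserman.
Variables (R : realType) (phi : R -> R) (eps : R).
Hypotheses (phi_ge0 : forall r : R, 0 <= r -> 0 <= phi r)
  (phi_cont : {within `[0, +oo[, continuous phi})
  (phi_nd : forall r s : R, 0 <= r -> r <= s -> phi r <= phi s)
  (eps0 : 0 < eps)
  (phi_int : (\int[@lebesgue_measure R]_(s in `[0%R, eps])
         (sqrte (\int[@lebesgue_measure R]_(r in `[0%R, s]) (phi r)%:E))^-1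
       < +oo)%E).

Let Phi := primitive R phi.

Lemma phi_integrable s : (@lebesgue_measure R).-integrable `[0, s] (EFin \o phi).
Proof.
apply: continuous_compact_integrable; first exact: segment_compact.
by apply: continuous_subspaceW phi_cont; apply: subset_itvl; rewrite bnd_simp.
Qed.

Lemma Phi_increment a b : 0 <= a -> a <= b ->
  0 <= Phi b - Phi a <= phi b * (b - a).
Proof.
move=> a0 ab; rewrite -[X in X <= _ <= _](mul0r (b - a)).
have [lo hi] := primitive_increment R phi b (phi_integrable b) a b a0 ab (lexx b).
have t0 t : a < t -> 0 <= t by move=> ta; rewrite (le_trans a0) // ltW.
apply/andP; split; first by apply: lo => t /t0 ? _; exact: phi_ge0.
by apply: hi => t /t0 ? ?; exact: phi_nd.
Qed.

Lemma Phi_ge0 s : 0 <= Phi s.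
Proof.
have [s0|s0] := leP 0 s; last by rewrite /Phi primitive_lt0.
by have := Phi_increment 0 s (lexx _) s0; rewrite /Phi primitive0 subr0 => /andP[].
Qed.

Lemma Phi_nd : {homo Phi : a b / a <= b}.
Proof.
move=> a b ab; have [a0|a0] := leP 0 a.
  by have /andP[+ _] := Phi_increment a b a0 ab; rewrite subr_ge0.
by rewrite {1}/Phi primitive_lt0 // Phi_ge0.
Qed.

Lemma PhiE s : (\int[@lebesgue_measure R]_(r in `[0%R, s]) (phi r)%:E)%E = (Phi s)%:E.
Proof.
rewrite /Phi /primitive /Rintegral fineK //.
exact: integrable_fin_num (phi_integrable s).
Qed.

(** If the primitive of phi vanished at s > 0, it would vanish on [0, s] by
monotonicity, and the integrand of the integral condition, whose value at zero
is +oo, would not be integrable. *)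
Lemma Phi_gt0 s : 0 < s -> 0 < Phi s.
Proof.
move=> s0; rewrite lt_neqAle Phi_ge0 andbT; apply/eqP => P0.
(* The condition only concerns [0, eps]. *)
pose s1 := Num.min s eps.
have s10 : 0 < s1 by rewrite lt_min s0 eps0.
have : (\int[@lebesgue_measure R]_(s in `[0%R, s1]) (cst +oo s) < +oo)%E.
  apply: le_lt_trans phi_int.
  rewrite [X in (X <= _)%E]integral_mkcond [X in (_ <= X)%E]integral_mkcond.
  apply: ge0_le_integral_nonmeasurable => x; rewrite !patchE.
    by case: ifP => // _; exact: leey.
  case: ifPn => [|_]; last first.
    by case: ifP => // _; rewrite inve_ge0 sqrte_ge0.
  rewrite inE /= in_itv /= /s1 le_min => /and3P[x0 xs xe].
  rewrite ifT; last by rewrite inE /= in_itv /= x0 xe.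
  rewrite PhiE; have -> : Phi x = 0.
    by apply/eqP; rewrite eq_le Phi_ge0 andbT P0 Phi_nd.
  by rewrite sqrte0 inve0.
rewrite integral_cst //= lebesgue_measure_itv /= lte_fin s10 sube0.
by rewrite gt0_mulye ?lte_fin// ltxx.
Qed.

(** The slope of the profile as a function of its height. *)
Definition speed (s : R) : R := Num.sqrt (Phi s).

Lemma speed_ge0 s : 0 <= speed s. Proof. exact: sqrtr_ge0. Qed.

Lemma speed_gt0 s : 0 < s -> 0 < speed s.
Proof. by move=> s0; rewrite sqrtr_gt0 Phi_gt0. Qed.

Lemma speed0 : speed 0 = 0.
Proof. by rewrite /speed /Phi primitive0 sqrtr0. Qed.

Lemma speed_nd : {homo speed : a b / a <= b}.
Proof. by move=> a b ab; apply: ler_wsqrtr; exact: Phi_nd. Qed.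

Lemma inv_speed_integrable :
  (@lebesgue_measure R).-integrable `[0, eps] (EFin \o (fun s => (speed s)^-1)).
Proof.
have mI : measurable (`[0, eps] : set (measurableTypeR R)) by [].
apply/integrableP; split.
  apply/measurable_EFinP.
  have -> : (fun s => (speed s)^-1) = (fun s => powR (speed s) (-1)).
    by apply/funext => s; rewrite powR_inv1 // speed_ge0.
  have ms : measurable_fun (`[0, eps] : set (measurableTypeR R)) speed.
    by apply: nondecreasing_measurable => //; exact: speed_nd.
  exact: (measurableT_comp (measurable_powR (-1)) ms).
apply: le_lt_trans phi_int.
rewrite [X in (X <= _)%E]integral_mkcond [X in (_ <= X)%E]integral_mkcond.
apply: ge0_le_integral_nonmeasurable => x; rewrite !patchE; first by case: ifP.
case: ifP => // _; rewrite PhiE /=.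
have [->|p0] := eqVneq (Num.sqrt (Phi x)) 0; first by rewrite inve0 leey.
rewrite inver (negbTE p0) lee_fin ger0_norm // invr_ge0; exact: sqrtr_ge0.
Qed.

Let T := primitive R (fun s => (speed s)^-1).

(** This double inequality is all that is used of the relation T' = 1/speed. *)
Lemma travel_time_increment a b : 0 <= a -> a <= b -> b <= eps ->
  speed a * (T b - T a) <= b - a <= speed b * (T b - T a).
Proof.
move=> a0 ab beps.
have [lo hi] := primitive_increment R _ eps inv_speed_integrable a b a0 ab beps.
apply/andP; split.
  have [a1|a1] := ltP 0 a; last first.
    have -> : a = 0 by lra.
    by rewrite speed0 mul0r; lra.
  rewrite -ler_pdivlMl ?speed_gt0//; apply: hi => t ta _.
  have t0 : 0 < t by exact: lt_trans ta.
  by rewrite lef_pV2 ?posrE ?speed_gt0//; apply: speed_nd; exact: ltW.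
have [b0|b0] := ltP 0 b; last first.
  have -> : b = 0 by lra.
  have -> : a = 0 by lra.
  by rewrite !subrr mulr0.
rewrite -ler_pdivrMl ?speed_gt0//; apply: lo => t ta tb.
have t0 : 0 < t by exact: le_lt_trans ta.
by rewrite lef_pV2 ?posrE ?speed_gt0 ?speed_nd.
Qed.

Lemma travel_time_continuous : {within `[0, eps], continuous T}.
Proof.
apply: parameterized_integral_continuous; first exact: ltW.
exact: inv_speed_integrable.
Qed.

Lemma travel_time_gt0 : 0 < T eps.
Proof.
have := travel_time_increment 0 eps (lexx _) (ltW eps0) (lexx _).
rewrite /T primitive0 !subr0 => /andP[_ H].
rewrite -(pmulr_rgt0 _ (speed_gt0 eps eps0)); exact: lt_le_trans H.
Qed.

(** The inverse U of the travel time T, with P its slope.  The last inequality is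
U'' <= phi(U) in integrated form: P^2 is the primitive of phi at U, so
P(b)^2 - P(a)^2 <= phi(U b) (U b - U a) <= phi(U b) P(b) (b - a), and dividing by
P(b) + P(a) >= P(b) gives the bound. *)
Lemma exists_profile : exists tau U P, [/\ 0 < tau,
  U 0 = 0, P 0 = 0,
  forall t, 0 < t -> t <= tau -> 0 < U t &
  forall a b, 0 <= a -> a <= b -> b <= tau ->
   [/\ 0 <= U a, U a <= U b, 0 <= P a <= P b,
       P a * (b - a) <= U b - U a <= P b * (b - a) &
       P b - P a <= phi (U b) * (b - a)]].
Proof.
have Tn0 : T 0 = 0 by rewrite /T primitive0.
have HU t : exists s, 0 <= t -> t <= T eps -> [/\ 0 <= s, s <= eps & T s = t].
  have [t0|t0] := leP 0 t; last by exists 0 => t0'; lra.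
  have [tT|tT] := leP t (T eps); last by exists 0 => _; lra.
  have [] := IVT (ltW eps0) travel_time_continuous (v := t).
    by rewrite Tn0 ge_min t0 le_max tT orbT.
  by move=> s; rewrite in_itv /= => /andP[? ?] ?; exists s.
pose U t := sval (cid (HU t)).
have UP t : 0 <= t -> t <= T eps -> [/\ 0 <= U t, U t <= eps & T (U t) = t].
  by rewrite /U; case: cid.
pose P t := speed (U t).
have U0 : U 0 = 0.
  have [u0 ue Tu] := UP 0 (lexx _) (ltW travel_time_gt0).
  have := travel_time_increment 0 (U 0) (lexx _) u0 ue.
  rewrite Tu Tn0 !subr0 mulr0 => /andP[_]; lra.
have mono a b : 0 <= a -> a <= b -> b <= T eps -> U a <= U b.
  move=> a0 ab bT; have [ua0 uae Ta] := UP a a0 (le_trans ab bT).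
  have [ub0 ube Tb] := UP b (le_trans a0 ab) bT.
  rewrite leNgt; apply/negP => uba.
  have /andP[_] := travel_time_increment _ _ ub0 (ltW uba) uae; rewrite Ta Tb.
  have := speed_ge0 (U a); nra.
exists (T eps), U, P; split=> //.
- exact: travel_time_gt0.
- by rewrite /P U0 speed0.
- move=> t t0 tT; have [u0 ue Tu] := UP t (ltW t0) tT.
  rewrite lt_neqAle u0 andbT; apply/eqP => ut.
  by move: t0; rewrite -Tu -ut Tn0 ltxx.
move=> a b a0 ab bT; have [ua0 uae Ta] := UP a a0 (le_trans ab bT).
have [ub0 ube Tb] := UP b (le_trans a0 ab) bT.
have uab := mono a b a0 ab bT.
have Pab : P a <= P b by exact: speed_nd.
have Pa0 : 0 <= P a := speed_ge0 (U a).
have /andP[inc1 inc2] : P a * (b - a) <= U b - U a <= P b * (b - a).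
  by have := travel_time_increment _ _ ua0 uab ube; rewrite Ta Tb.
split=> //; rewrite ?Pa0 ?Pab ?inc1 ?inc2//.
have PhiP t : P t ^+ 2 = Phi (U t) by rewrite sqr_sqrtr // Phi_ge0.
have := Phi_increment _ _ ua0 uab; rewrite -!PhiP => /andP[_ H].
have f0 : 0 <= phi (U b) by exact: phi_ge0.
have H2 := ler_wpM2l f0 inc2.
set X := phi (U b) * (b - a).
have X0 : 0 <= X by rewrite mulr_ge0 // subr_ge0.
have H3 : (P b - P a) * (P b + P a) <= X * P b by rewrite /X; lra.
rewrite leNgt; apply/negP => HX; nra.
Qed.
End osserman.

(** * The barrier in one variable *)

Section barrier.
Variables (R : realType) (phi U P : R -> R) (tau theta : R).
Hypotheses (phi_ge0 : forall r : R, 0 <= r -> 0 <= phi r)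
  (phi_nd : forall r s : R, 0 <= r -> r <= s -> phi r <= phi s)
  (theta0 : 0 < theta) (theta_tau : theta < tau)
  (U0 : U 0 = 0) (P0 : P 0 = 0)
  (UP : forall a b, 0 <= a -> a <= b -> b <= tau ->
   [/\ 0 <= U a, U a <= U b, 0 <= P a <= P b,
       P a * (b - a) <= U b - U a <= P b * (b - a) &
       P b - P a <= phi (U b) * (b - a)]).

(** The even extension of U, stopped at height U(theta): the truncation makes it
a function on the whole line without losing the supersolution property, since a
minimum of supersolutions is one. *)
Definition trunc_profile (t : R) : R := U (Num.min `|t| theta).

Lemma trunc_range (t : R) : 0 <= Num.min `|t| theta <= theta.
Proof. by rewrite le_min normr_ge0 (ltW theta0) ge_min lexx orbT. Qed.

Lemma trunc_profile0 : trunc_profile 0 = 0.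
Proof. by rewrite /trunc_profile normr0 min_l // ltW. Qed.

Lemma trunc_profile_ge0 t : 0 <= trunc_profile t.
Proof.
have /andP[m0 mt] := trunc_range t.
by have [] := UP _ _ (lexx 0) m0 (le_trans mt (ltW theta_tau)); rewrite U0.
Qed.

Lemma trunc_profile_far t : theta <= `|t| -> trunc_profile t = U theta.
Proof. by move=> tt; rewrite /trunc_profile min_r. Qed.

Lemma trunc_profile_le s b : `|s| <= b -> b <= tau -> trunc_profile s <= U b.
Proof.
move=> sb bt; have /andP[m0 mt] := trunc_range s.
have [] // := UP (Num.min `|s| theta) b m0 _ bt.
by rewrite ge_min sb.
Qed.

Lemma P_tau_ge0 : 0 <= P tau.
Proof.
have t0 : 0 <= tau by move: theta0 theta_tau; lra.
by have [_ _ /andP[+ +] _ _] := UP _ _ (lexx 0) t0 (lexx tau); rewrite P0.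
Qed.

Lemma profile_lip a b : 0 <= a -> a <= b -> b <= tau ->
  U b - U a <= P tau * (b - a).
Proof.
move=> a0 ab bt; have [_ _ _ /andP[_ H] _] := UP a b a0 ab bt.
have [_ _ /andP[_ Pb] _ _] := UP b tau (le_trans a0 ab) bt (lexx tau).
by apply: le_trans H _; rewrite ler_wpM2r // subr_ge0.
Qed.

Lemma trunc_profile_lip s t :
  `|trunc_profile s - trunc_profile t| <= P tau * `|s - t|.
Proof.
have H x y : `|x| <= `|y| ->
    `|trunc_profile x - trunc_profile y| <= P tau * `|x - y|.
  move=> xy; rewrite /trunc_profile.
  set a := Num.min `|x| theta; set b := Num.min `|y| theta.
  have /andP[a0 _] : 0 <= a <= theta := trunc_range x.
  have /andP[b0 bth] : 0 <= b <= theta := trunc_range y.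
  have ab : a <= b by rewrite /b le_min ge_min xy /= ge_min lexx orbT.
  have bt : b <= tau by rewrite (le_trans bth) // ltW.
  have [_ Uab _ _ _] := UP a b a0 ab bt.
  rewrite distrC ger0_norm ?subr_ge0//; apply: le_trans (profile_lip a b a0 ab bt) _.
  rewrite ler_wpM2l ?P_tau_ge0//.
  have : `|y| - `|x| <= `|x - y| by rewrite distrC; exact: lerB_dist.
  rewrite /a /b; case: (leP `|x| theta) => xt; case: (leP `|y| theta) => yt; lra.
have [st|ts] := leP `|s| `|t|; first exact: H.
by rewrite distrC (distrC s); apply: H; exact: ltW.
Qed.

(** Away from 0 the second difference is at most h (P(t + h) - P(t - h)), which the
slope estimate bounds.  If 0 lies between t - h and t + h, all three values are
at most U(t + h) <= P(t + h) (t + h), and P(t + h) is of order h because P 0 = 0.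
Beyond the truncation the second difference is nonpositive. *)
Lemma trunc_profile_diff2 t h : 0 < h -> h <= tau - theta ->
  trunc_profile (t + h) + trunc_profile (t - h) - 2 * trunc_profile t <=
  8 * h ^+ 2 * phi (trunc_profile t + P tau * h).
Proof.
move=> h0 htau.
have even s : trunc_profile (- s) = trunc_profile s by rewrite /trunc_profile normrN.
wlog t0 : t / 0 <= t => [H|].
  have [t0|t0] := leP 0 t; first exact: H.
  have := H (- t); rewrite oppr_ge0 (ltW t0) => /(_ isT).
  have -> : - t + h = - (t - h) by ring.
  have -> : - t - h = - (t + h) by ring.
  by rewrite !even; lra.
have far_le s : trunc_profile s <= U theta.
  have /andP[m0 mt] := trunc_range s.
  by have [] := UP _ _ m0 mt (ltW theta_tau).
have Et := trunc_profile_ge0 t.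
have Pt := P_tau_ge0.
have h2 : 0 <= h ^+ 2 by exact: sqr_ge0.
have RHS0 : 0 <= phi (trunc_profile t + P tau * h).
  by apply: phi_ge0; rewrite addr_ge0 // mulr_ge0 // ltW.
have [tth|tth] := leP theta t.
  rewrite (trunc_profile_far t) ?ger0_norm//.
  have := far_le (t + h); have := far_le (t - h).
  move: RHS0; rewrite (trunc_profile_far t) ?ger0_norm// => RHS0; nra.
have Ut : trunc_profile t = U t by rewrite /trunc_profile ger0_norm // min_l // ltW.
have tht : t + h <= tau by lra.
have th0 : 0 <= t + h by lra.
have tth' : t <= t + h by lra.
have phile : phi (U (t + h)) <= phi (trunc_profile t + P tau * h).
  apply: phi_nd; first by have [] := UP _ _ (lexx 0) th0 tht; rewrite U0.
  by rewrite Ut; have := profile_lip t (t + h) t0 tth' tht; lra.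
have Eth : trunc_profile (t + h) <= U (t + h).
  by apply: trunc_profile_le; rewrite ?ger0_norm.
set F := phi (trunc_profile t + P tau * h) in RHS0 phile *.
have [Uth0 _ /andP[_ Pth0] /andP[_ inc0] Pinc0] := UP 0 (t + h) (lexx 0) th0 tht.
rewrite P0 U0 !subr0 in Pth0 inc0 Pinc0.
have [Ut0 Utth /andP[Pt0 Ptth] /andP[_ inc1] _] := UP t (t + h) t0 tth' tht.
have [hlet|tlth] := leP h t.
  have Etmh : trunc_profile (t - h) <= U (t - h).
    by apply: trunc_profile_le; rewrite ?ger0_norm; lra.
  have tmh0 : 0 <= t - h by lra.
  have tmht : t - h <= t by lra.
  have [_ _ _ /andP[inc2 _] _] := UP (t - h) t tmh0 tmht (ltW (lt_trans tth theta_tau)).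
  have tmhth : t - h <= t + h by lra.
  have [_ _ _ _ Pinc] := UP (t - h) (t + h) tmh0 tmhth tht.
  have D1 : U (t + h) - U t - (U t - U (t - h)) <= h * (P (t + h) - P (t - h)).
    have e1 : t + h - t = h by ring. have e2 : t - (t - h) = h by ring.
    rewrite e1 in inc1; rewrite e2 in inc2; lra.
  have e3 : t + h - (t - h) = 2 * h by ring.
  rewrite e3 in Pinc.
  have D2 : P (t + h) - P (t - h) <= F * (2 * h).
    apply: le_trans Pinc _; rewrite ler_wpM2r //; lra.
  have D3 := ler_wpM2l (ltW h0) D2.
  have FH : 0 <= F * h ^+ 2 by rewrite mulr_ge0.
  rewrite Ut; lra.
have Etmh : trunc_profile (t - h) <= U (t + h).
  by apply: trunc_profile_le => //; rewrite ler_norml; lra.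
have th2 : t + h <= 2 * h by lra.
have D1 : P (t + h) <= F * (2 * h).
  apply: le_trans Pinc0 _; rewrite ler_pM ?phi_ge0//; exact: le_trans Utth.
have D2 : U (t + h) <= F * (2 * h) * (2 * h).
  by apply: le_trans inc0 _; apply: ler_pM.
lra.
Qed.
End barrier.

(** * The minimum principle for harmonic functions *)

(** If l < 0, the increment g(s) + g(-s) - 2 g(0) would be negative for small s,
by the mean value theorem and the sign of g'(xi) - g'(-xi). *)
Lemma second_derivative_min (R : realType) (g g' : R -> R) (l d0 : R) : 0 < d0 ->
  (forall s : R, `|s| < d0 -> is_derive s 1 g (g' s)) -> is_derive (0 : R) 1 g' l ->
  (forall s : R, `|s| < d0 -> g 0 <= g s) -> 0 <= l.
Proof.
move=> d00 dg [dg' dl] gmin; rewrite leNgt; apply/negP => l0.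
have : h^-1 *: ((g' \o shift 0) (h *: 1) - g' 0) @[h --> (0:R)^'] --> l.
  by rewrite -dl; exact: dg'.
have l2 : 0 < - l / 2 by lra.
move=> /cvgrPdist_le/(_ _ l2)[d /= dd0 H].
pose s := Num.min d d0 / 2.
have m0 : 0 < Num.min d d0 by rewrite lt_min dd0.
have s0 : 0 < s by rewrite divr_gt0.
have : s < Num.min d d0 by rewrite /s; lra.
rewrite lt_min => /andP[sd sd0].
have quot x : x != 0 -> `|x| < d -> x^-1 * (g' x - g' 0) <= l / 2.
  move=> x0 xd; have := H x; rewrite /ball_ /= sub0r normrN => /(_ xd x0).
  rewrite addr0 /GRing.scale /= mulr1 ler_norml => /andP[+ _]; lra.
pose k t := g t + g (- t).
have dk (t : R) : `|t| < d0 -> is_derive t 1 k (g' t - g' (- t)).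
  move=> td; have d1 := dg t td.
  have dn : is_derive t 1 (fun t : R => - t) (- 1) by exact: is_deriveN.
  have d2 : is_derive (- t) 1 g (g' (- t)) by apply: dg; rewrite normrN.
  have d3 := @is_derive1_comp _ g (fun t : R => - t) t _ _ d2 dn.
  rewrite mulrN1 in d3; exact: is_deriveD.
have near0 x : x \in `[0, s] -> `|x| < d0.
  by rewrite in_itv /= => /andP[x0 xs]; rewrite ger0_norm // (le_lt_trans xs).
have [||xi xiI Hk] := @MVT _ k (fun t => g' t - g' (- t)) 0 s s0.
- move=> x xI; apply/dk/near0; move: xI; rewrite !in_itv /=.
  by move=> /andP[/ltW -> /ltW ->].
- apply: derivable_within_continuous => x /near0 xd.
  by have [] := dk x xd.
move: xiI; rewrite in_itv /= => /andP[xi0 xis].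
have xid : `|xi| < d by rewrite gtr0_norm // (lt_trans xis).
have q1 := quot xi (lt0r_neq0 xi0) xid.
have := quot (- xi); rewrite oppr_eq0 normrN (lt0r_neq0 xi0) => /(_ isT xid) q2.
rewrite ler_pdivrMl // in q1.
rewrite invrN mulNr -mulrN ler_pdivrMl // in q2.
have k0 : k 0 <= k s.
  rewrite /k oppr0; apply: lerD; apply: gmin; rewrite ?normrN gtr0_norm //.
have : (g' xi - g' (- xi)) * (s - 0) < 0.
  rewrite nmulr_rlt0 ?subr0 //; nra.
by move: k0; lra.
Qed.

Lemma is_derive_line (R : realType) N (f : 'rV[R]_N -> R) (x : 'rV[R]_N) i (s : R) :
  derivable f (x + s *: 'e_i) 'e_i ->
  is_derive s 1 (fun s => f (x + s *: 'e_i)) (partial i f (x + s *: 'e_i)).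
Proof.
move=> df; rewrite /partial.
have E : (fun h => h^-1 *:
      (((fun s => f (x + s *: 'e_i)) \o shift s) (h *: 1) - f (x + s *: 'e_i))) =
    (fun h => h^-1 *:
      ((f \o shift (x + s *: 'e_i)) (h *: 'e_i) - f (x + s *: 'e_i))).
  apply/funext => h /=; congr (_ *: (f _ - _)).
  by rewrite [h%:A]mulr1 scalerDl addrCA.
apply: DeriveDef.
  by rewrite /derivable E.
by rewrite /derive E.
Qed.

(** At an interior minimum of h - eta |x - x0|^2 each second partial derivative of h
is at least 2 eta, so the Laplacian could not vanish. *)
Lemma harmonic_min (R : realType) N (D : set 'rV[R]_N) (h : 'rV[R]_N -> R) c :
  (0 < N)%N -> open D -> bounded_set D -> {within closure D, continuous h} ->
  harmonic_on D h -> (forall x, boundary D x -> c <= h x) ->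
  forall x, D x -> c <= h x.
Proof.
move=> N0 oD bD ch [C2 lap] hb x0 Dx0; rewrite leNgt; apply/negP => hc.
have cv : {within closure D, continuous (fun x => c - h x)}.
  move=> x; apply: (@continuousB _ _ (subspace (closure D)) (cst c) h); last exact: ch.
  exact: cst_continuous.
have vb x : boundary D x -> c - h x <= 0 by move=> /hb; rewrite subr_le0.
have v0 : 0 < c - h x0 by rewrite subr_gt0.
have [eta [x1 [eta0 Dx1 v1 vmax]]] := perturbed_max R N D _ x0 oD bD cv vb Dx0 v0.
have [d d0 HD] : exists2 d, 0 < d & forall x, `|x1 - x| < d -> D x.
  have /nbhs_ballP[d /= d0 H] : nbhs x1 D by exact: open_nbhs_nbhs.
  by exists d => // x xd; apply: H; rewrite -ball_normE.
have lineD i s : `|s| < d -> D (x1 + s *: 'e_i).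
  move=> sd; apply: HD; rewrite opprD addrA subrr add0r normrN.
  by apply: le_lt_trans sd; apply: norm_shift_basis.
have dd i : 2 * eta <= partial i (partial i h) x1.
  have [dh [_ C1]] := (C2.2 i).
  have [ddh _] := C1 i.
  rewrite -subr_ge0.
  pose beta := x1 ord0 i - x0 ord0 i.
  pose g s := h (x1 + s *: 'e_i) - eta * (beta + s) ^+ 2.
  pose g' s := partial i h (x1 + s *: 'e_i) - 2 * eta * (beta + s).
  apply: (second_derivative_min R g g' _ d d0).
  - move=> s sd.
    have d1 := is_derive_line R N h x1 i s (dh _ (lineD i s sd)).
    have d2 : is_derive s 1 (fun s => eta * (beta + s) ^+ 2) (2 * eta * (beta + s)).
      have -> : (fun s : R => eta * (beta + s) ^+ 2) = eta *: ((cst beta + id) ^+ 2).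
        by apply/funext.
      apply: is_derive_eq; rewrite /GRing.scale /= !fctE /=; ring.
    exact: is_deriveB.
  - have ddh0 : derivable (partial i h) (x1 + 0 *: 'e_i) 'e_i.
      by rewrite scale0r addr0; exact: ddh.
    have := is_derive_line R N (partial i h) x1 i 0 ddh0.
    rewrite scale0r addr0 => d1.
    have d2 : is_derive (0 : R) 1 (fun s => 2 * eta * (beta + s)) (2 * eta).
      have -> : (fun s : R => 2 * eta * (beta + s)) = (2 * eta) *: (cst beta + id).
        by apply/funext.
      by apply: is_derive_eq; rewrite /GRing.scale /= add0r mulr1.
    exact: is_deriveB.
  - move=> s sd; have := vmax _ (lineD i s sd).
    have S (t : R) : sqdist R N x0 (x1 + t *: 'e_i) = (beta + t) ^+ 2 +
       \sum_(j | j != i) (x1 ord0 j - x0 ord0 j) ^+ 2.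
      rewrite /sqdist (bigD1 i)//= !mxE !eqxx /= mulr1 /beta.
      congr (_ + _); first by ring.
      by apply: eq_bigr => j ji; rewrite !mxE (negbTE ji) andbF mulr0 addr0.
    have := S 0; rewrite /g scale0r !addr0 S => ->; lra.
have := lap x1 Dx1; rewrite /laplacian => L0.
have : \sum_(i < N) (2 * eta) <= \sum_(i < N) partial i (partial i h) x1.
  by apply: ler_sum => i _; exact: dd.
rewrite L0.
rewrite sumr_const card_ord -[_ *+ N]mulr_natl.
have : 0 < N%:R * (2 * eta) by rewrite !mulr_gt0 // ltr0n.
lra.
Qed.

(** * The barrier in several variables *)

Section separable_barrier.
Variables (R : realType) (N : nat) (phi E : R -> R) (K d : R) (b : 'rV[R]_N).
Hypotheses (N0 : (0 < N)%N)
  (phi_ge0 : forall r : R, 0 <= r -> 0 <= phi r)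
  (phi_nd : forall r s : R, 0 <= r -> r <= s -> phi r <= phi s)
  (d0 : 0 < d) (K0 : 0 <= K)
  (E0 : E 0 = 0) (E_ge0 : forall t, 0 <= E t)
  (E_lip : forall s t, `|E s - E t| <= K * `|s - t|)
  (E_diff2 : forall t h, 0 < h -> h <= d ->
     E (t + h) + E (t - h) - 2 * E t <= 8 * h ^+ 2 * phi (E t + K * h)).

Let c : R := (2 * N%:R)^-1.

(** The factor c = 1/(2N) scales the N second differences, each of size
8 (c h)^2 phi, down to a total of at most 2 h^2 phi. *)
Definition sum_barrier (x : 'rV[R]_N) : R := \sum_i E (c * (x ord0 i - b ord0 i)).

Lemma barrier_scale_gt0 : 0 < c.
Proof. by rewrite invr_gt0 mulr_gt0 // ltr0n. Qed.

Lemma barrier_scale_le1 : c <= 1.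
Proof.
have N1 : 1 <= N%:R :> R by rewrite ler1n.
by rewrite invf_le1; lra.
Qed.

Lemma sum_barrier_ge0 x : 0 <= sum_barrier x.
Proof. exact: sumr_ge0. Qed.

Lemma sum_barrier_center : sum_barrier b = 0.
Proof. by rewrite /sum_barrier big1 // => i _; rewrite subrr mulr0. Qed.

Lemma sum_barrier_ge i (x : 'rV[R]_N) : E (c * (x ord0 i - b ord0 i)) <= sum_barrier x.
Proof. by rewrite /sum_barrier (bigD1 i)//= lerDl; exact: sumr_ge0. Qed.

Lemma sum_barrier_continuous : continuous sum_barrier.
Proof.
apply: (continuous_sum_coord R N (fun i t => E (c * (t - b ord0 i)))) => i t.
apply/continuous_distP => e e0.
have K1 : 0 < K + 1 by move: K0; lra.
exists (e / (K + 1)); first by rewrite divr_gt0.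
move=> s ts; apply: le_trans (E_lip _ _) _.
rewrite -mulrBr opprB addrA subrK normrM (gtr0_norm barrier_scale_gt0).
apply: (@le_trans _ _ ((K + 1) * `|t - s|)); last first.
  by rewrite -ler_pdivlMl // mulrC ltW.
apply: ler_pM; rewrite ?mulr_ge0 ?(ltW barrier_scale_gt0)//; first by rewrite lerDl.
by rewrite ler_piMl // barrier_scale_le1.
Qed.

Lemma sum_barrier_diff2 sigma : 0 < sigma ->
  exists2 h0, 0 < h0 & forall h y, 0 < h -> h < h0 ->
     \sum_i diff2 R N sum_barrier h i y <= 2 * h ^+ 2 * phi (sum_barrier y + sigma).
Proof.
move=> s0; have K1 : 0 < K + 1 by move: K0; lra.
exists (Num.min d (sigma / (K + 1))); first by rewrite lt_min d0 divr_gt0.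
move=> h y h0; rewrite lt_min => /andP[hd hs].
have ch0 : 0 < c * h by rewrite mulr_gt0 // barrier_scale_gt0.
have chh : c * h <= h by rewrite ler_piMl ?barrier_scale_le1 // ltW.
have Kh : K * (c * h) <= sigma.
  have : (K + 1) * (c * h) <= (K + 1) * (sigma / (K + 1)).
    by rewrite ler_wpM2l ?(ltW K1)// (le_trans chh)// ltW.
  by rewrite [X in _ <= X]mulrC divfK ?gt_eqF//; move: ch0; lra.
have dE i : diff2 R N sum_barrier h i y <=
    8 * (c * h) ^+ 2 * phi (sum_barrier y + sigma).
  have S (s : R) : sum_barrier (y + s *: 'e_i) =
     E (c * (y ord0 i - b ord0 i) + c * s) +
     \sum_(j | j != i) E (c * (y ord0 j - b ord0 j)).
    rewrite /sum_barrier (bigD1 i)//= !mxE !eqxx /= mulr1.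
    congr (E _ + _); first by ring.
    by apply: eq_bigr => j ji; rewrite !mxE (negbTE ji) andbF mulr0 addr0.
  have S0 := S 0; rewrite scale0r mulr0 !addr0 in S0.
  have Sm := S (- h); rewrite scaleNr mulrN in Sm.
  have := E_diff2 (c * (y ord0 i - b ord0 i)) (c * h) ch0 (le_trans chh (ltW hd)).
  have ph : phi (E (c * (y ord0 i - b ord0 i)) + K * (c * h)) <=
      phi (sum_barrier y + sigma).
    apply: phi_nd; last by apply: lerD => //; exact: sum_barrier_ge.
    by rewrite addr_ge0 // mulr_ge0 // ltW.
  have c2 : 0 <= 8 * (c * h) ^+ 2 by rewrite mulr_ge0 // exprn_ge0 // ltW.
  have := ler_wpM2l c2 ph.
  by rewrite /diff2 S Sm S0; lra.
apply: le_trans (ler_sum _ (fun i _ => dE i)) _.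
rewrite sumr_const card_ord -[_ *+ N]mulr_natl mulrA ler_wpM2r //.
  by apply: phi_ge0; rewrite addr_ge0 ?sum_barrier_ge0 // ltW.
have N1 : 1 <= N%:R :> R by rewrite ler1n.
have cN : c * N%:R = 2^-1 by rewrite /c invfM -mulrA mulVf ?mulr1// pnatr_eq0 -lt0n.
rewrite exprMn (_ : N%:R * _ = 4 * (c * (2 * (c * N%:R))) * h ^+ 2); last by ring.
rewrite cN divff // mulr1 ler_wpM2r ?exprn_ge0 // ?(ltW h0) //.
by move: cN; have := barrier_scale_gt0; nra.
Qed.
End separable_barrier.

(** * A constant boundary function with a dead core *)

Lemma harmonic_cst (R : realType) N (D : set 'rV[R]_N) (c : R) :
  harmonic_on D (cst c).
Proof.
have pc k i : partial i (cst k : 'rV[R]_N -> R) = cst 0.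
  by apply/funext => x; rewrite /partial derive_cst.
split; last by move=> x _; rewrite /laplacian big1 // => i _; rewrite !pc.
have C k : forall r, C_on k D (cst r : 'rV[R]_N -> R).
  elim: k => [|k IH] r; first by split => // x _; exact: cst_continuous.
  split=> [x _|i]; first exact: cst_continuous.
  split; first by move=> x _; exact: derivable_cst.
  by rewrite pc.
exact: C.
Qed.

Theorem theorem4p2 (R : realType) (N : nat) (N_ge3 : (3 <= N)%N)
    (D : set 'rV[R]_N) (D_lip : bounded_lipschitz_domain D)
    (phi : R -> R)
    (phi_ge0 : forall r : R, 0 <= r -> 0 <= phi r)
    (phi_cont : {within `[0, +oo[, continuous phi})
    (phi_nd : forall r s : R, 0 <= r -> r <= s -> phi r <= phi s)
    (phi0 : phi 0 = 0)
    (phi_int : exists2 eps : R, 0 < eps &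
      (\int[@lebesgue_measure R]_(s in `[0%R, eps])
         (sqrte (\int[@lebesgue_measure R]_(r in `[0%R, s]) (phi r)%:E))^-1
       < +oo)%E) :
  exists f : 'rV[R]_N -> R,
    [/\ {within boundary D, continuous f},
        forall x, boundary D x -> 0 <= f x &
        ~ proportional_on D (HDphi D phi f) (HD D f)].
Proof.
case: D_lip => -[x0 Dx0] oD _ bD _.
have N0 : (0 < N)%N by exact: leq_trans N_ge3.
have [eps eps0 eps_int] := phi_int.
have [tau [U [P [tau0 U0 P0 Upos UP]]]] :=
  exists_profile R phi eps phi_ge0 phi_cont phi_nd eps0 eps_int.
have [d d0 HDd] : exists2 d, 0 < d & forall x, `|x0 - x| < d -> D x.
  have /nbhs_ballP[d /= d0 H] : nbhs x0 D by exact: open_nbhs_nbhs.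
  by exists d => // x xd; apply: H; rewrite -ball_normE.
pose c : R := (2 * N%:R)^-1.
have c0 : 0 < c := barrier_scale_gt0 R N N0.
(* theta < c * d: outside the ball of radius d around x0 some coordinate of
x - x0 is so large that its term of the barrier has reached U theta. *)
pose theta := Num.min tau (c * d) / 2.
have m0 : 0 < Num.min tau (c * d) by rewrite lt_min tau0 mulr_gt0.
have th0 : 0 < theta by rewrite divr_gt0.
have [tht thd] : theta < tau /\ theta < c * d.
  by apply/andP; rewrite -lt_min /theta; lra.
pose E := trunc_profile R U theta.
have K0 : 0 <= P tau := P_tau_ge0 R phi U P tau theta th0 tht P0 UP.
have Ege0 t : 0 <= E t := trunc_profile_ge0 R phi U P tau theta th0 tht U0 UP t.
have Elip := trunc_profile_lip R phi U P tau theta th0 tht P0 UP.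
have Ediff2 :=
  trunc_profile_diff2 R phi U P tau theta phi_ge0 phi_nd th0 tht U0 P0 UP.
have dtt : 0 < tau - theta by rewrite subr_gt0.
pose w := sum_barrier R N E x0.
have Uth : 0 < U theta by apply: Upos => //; exact: ltW.
have w_out x : ~ D x -> U theta <= w x.
  move=> nDx; have xd : d <= `|x0 - x| by rewrite leNgt; apply/negP => /HDd.
  have [i xi] : exists i, d * (theta / (c * d)) < `|(x0 - x) ord0 i|.
    apply: norm_gtP; first by rewrite mulr_ge0 ?divr_ge0 ?mulr_ge0 ?ltW.
    by apply: (lt_le_trans _ xd); rewrite gtr_pMr // ltr_pdivrMr ?mul1r// mulr_gt0.
  apply: le_trans (sum_barrier_ge R N E x0 Ege0 i x).
  rewrite /E trunc_profile_far // normrM (gtr0_norm c0) -ler_pdivrMl // distrC.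
  move: xi; rewrite !mxE => /ltW; apply: le_trans.
  rewrite (_ : d * _ = c^-1 * theta) //; field; rewrite !gt_eqF //.
exists (cst (U theta)); split.
- by apply: continuous_subspaceT => x; exact: cst_continuous.
- by move=> x _; exact: ltW.
have Hh : dirichlet_solution D (cst (U theta)) (HD D (cst (U theta))).
  rewrite /HD; apply: (@getPex _ [set h | dirichlet_solution D (cst (U theta)) h]).
  exists (cst (U theta)); split => //; last exact: harmonic_cst.
  by apply: continuous_subspaceT => x; exact: cst_continuous.
have h_ge : U theta <= HD D (cst (U theta)) x0.
  case: Hh => ch hh hb; apply: (harmonic_min R N D _ _ N0 oD bD ch hh) => //.
  by move=> x /hb ->.
have u_le : HDphi D phi (cst (U theta)) x0 <= 0.
  have [[u su]|nsu] := pselect (exists u, semilinear_solution D phi (cst (U theta)) u).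
    have : semilinear_solution D phi (cst (U theta)) (HDphi D phi (cst (U theta))).
      apply: (@getPex _ [set u | semilinear_solution D phi (cst (U theta)) u]).
      by exists u.
    move=> [cu u0 uphi ub].
    have w0 : w x0 = 0.
      apply: sum_barrier_center; exact: (trunc_profile0 R U theta th0 U0).
    rewrite -w0.
    apply: (comparison R N D phi _ w N0 oD bD phi_cont phi_nd cu u0 uphi) => //.
    - exact: (sum_barrier_continuous R N E (P tau) x0 N0 K0 Elip).
    - exact: (sum_barrier_ge0 R N E x0 Ege0).
    - exact: (sum_barrier_diff2 R N phi E (P tau) (tau - theta) x0 N0
        phi_ge0 phi_nd dtt K0 Ege0 Ediff2).
    - move=> x bx; rewrite ub //; apply: w_out.
      by case: bx => _; rewrite ((interior_id D).1 oD).
  (* Without a solution the value chosen is the zero function. *)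
  rewrite /HDphi (_ : get _ = point) //.
  by apply: getPN => u su; apply: nsu; exists u.
move=> [k k0 /(_ x0 Dx0)/andP[+ _]].
have : 0 < k^-1 * HD D (cst (U theta)) x0.
  by rewrite mulr_gt0 ?invr_gt0 // (lt_le_trans Uth).
by move: u_le; lra.
Qed.
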